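(* Let $\mathcal X=\{\boldsymbol x:\boldsymbol A\boldsymbol x\le\boldsymbol h\}$ be the feasible polyhedron, $\boldsymbol f$ the convex quadratic cost, $\Psi(\boldsymbol x,\boldsymbol\xi)=\max_{1\le k\le K}\big(\boldsymbol a_k(\boldsymbol x)^\top\boldsymbol\xi+b_k(\boldsymbol x)\big)$ the penalty function with $K=4^G\times 3^L$, and $\mathcal M=\mathcal M_1\cap\mathcal M_2$ the ambiguity set, all as specified in the context. Then the distributionally robust problem $$\min_{\boldsymbol x}\ \boldsymbol f(\boldsymbol x)+\max_{\mu\in\mathcal M}\mathbb E_{\mu}[\Psi(\boldsymbol x,\boldsymbol\xi)]\quad\text{s.t.}\quad \boldsymbol A\boldsymbol x\le\boldsymbol h$$ admits the following conic program reformulation: $$\min_{\substack{\boldsymbol x,\ \boldsymbol y,\ \boldsymbol\zeta\\ \lambda\ge 0,\ \boldsymbol\Gamma\succeq 0}}\ \boldsymbol f(\boldsymbol x)+\lambda\theta+\tau\,\mathrm{tr}(\boldsymbol\Gamma\hat{\boldsymbol\Sigma})+\frac1N\sum_{n=1}^N y_n$$ subject to, for all $1\le k\le K$ and $1\le n\le N$, $$\begin{bmatrix}\boldsymbol\Gamma & -\tfrac12\boldsymbol a_k(\boldsymbol x)+\tfrac12\boldsymbol\zeta^{nk}-\boldsymbol\Gamma\hat{\boldsymbol m}\\ \big(-\tfrac12\boldsymbol a_k(\boldsymbol x)+\tfrac12\boldsymbol\zeta^{nk}-\boldsymbol\Gamma\hat{\boldsymbol m}\big)^\top & y_n-b_k(\boldsymbol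 x)-(\boldsymbol\zeta^{nk})^\top\hat{\boldsymbol\xi}^n+\hat{\boldsymbol m}^\top\boldsymbol\Gamma\hat{\boldsymbol m}\end{bmatrix}\succeq 0,$$ $$\|\boldsymbol\zeta^{nk}\|_*\le\lambda,$$ and $\boldsymbol A\boldsymbol x\le\boldsymbol h$. Here $\boldsymbol y=(y_1,\dots,y_N)\in\mathbb R^N$, $\boldsymbol\zeta=(\boldsymbol\zeta^{nk})_{n,k}$ with each $\boldsymbol\zeta^{nk}\in\mathbb R^{W+L}$, $\lambda\in\mathbb R$, and $\boldsymbol\Gamma$ is a symmetric $(W+L)\times(W+L)$ real matrix. That is, for every $\boldsymbol x$ with $\boldsymbol A\boldsymbol x\le\boldsymbol h$, the value $\boldsymbol f(\boldsymbol x)+\sup_{\mu\in\mathcal M}\mathbb E_\mu[\Psi(\boldsymbol x,\boldsymbol\xi)]$ equals the infimum of the objective of the second problem over $(\boldsymbol y,\boldsymbol\zeta,\lambda,\boldsymbol\Gamma)$ satisfying its constraints with that $\boldsymbol x$ fixed; in particular the two problems have the same optimal value.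
   Context: Index sets and data. $\mathcal G,\mathcal D,\mathcal W,\mathcal L$ are finite nonempty sets (generators, loads, wind farms, lines), with $G=|\mathcal G|$, $W=|\mathcal W|$, $L=|\mathcal L|$. Given real data: $\underline p_g\le\bar p_g$ ($g\in\mathcal G$); $p_w$ ($w\in\mathcal W$); $p_d$ ($d\in\mathcal D$); $p_l$ ($l\in\mathcal L$); $\pi_{gl},\pi_{wl},\pi_{dl}$; penalty coefficients $\beta_d,\beta_w,\beta_l\ge 0$ (three constants: load shedding, wind curtailment, line overload); and strictly convex quadratic functions $f_g,f_g^+,f_g^-:\mathbb R\to\mathbb R$. Decision vector. $\boldsymbol x=(p_g,r_g^+,r_g^-,\alpha_g)_{g\in\mathcal G}\in\mathbb R^{4G}$, and $\boldsymbol f(\boldsymbol x)=\sum_{g}\big(f_g(p_g)+f_g^+(r_g^+)+f_g^-(r_g^-)\big)$. The system $\boldsymbol A\boldsymbol x\le\boldsymbol h$ encodes the linear constraints - $\sum_g p_g+\sum_w p_w-\sum_d p_d=0$; - $\big|\sum_g\pi_{gl}p_g+\sum_w\pi_{wl}p_w-\sum_d\pi_{dl}p_d\big|\le p_l$ for all $l$; - $\underline p_g\le p_g\le\bar p_g$, $0\le r_g^+\le\bar p_g-p_g$, $0\le r_g^-\le p_g-\underline p_g$, $0\le\alpha_g\le1$ for all $g$; - $\sum_g\alpha_g=1$. Random vector. $\boldsymbol\xi=\big((\tilde p_w)_{w\in\mathcal W},(\tilde p_l)_{l\in\mathcal L}\big)\in\mathbb R^{W+L}$. Penalty function. With $(t)^+=\max(t,0)$,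 $$\Psi(\boldsymbol x,\boldsymbol\xi)=\beta_d\sum_{g}\Big(\alpha_g\sum_w(p_w-\tilde p_w)-r_g^+\Big)^+ +\beta_w\sum_g\Big(\alpha_g\sum_w(\tilde p_w-p_w)-r_g^-\Big)^+ +\beta_l\sum_{l}\Big(|F_l(\boldsymbol x,\boldsymbol\xi)|-\tilde p_l\Big)^+,$$ $$F_l(\boldsymbol x,\boldsymbol\xi)=\sum_g\pi_{gl}\Big(p_g+\alpha_g\sum_w(p_w-\tilde p_w)\Big)+\sum_w\pi_{wl}\tilde p_w-\sum_d\pi_{dl}p_d.$$ Affine pieces. The index set $\{1,\dots,K\}$, $K=4^G\times3^L$, is identified with the set of all tuples $k=\big((j_{g_d})_{g\in\mathcal G},(j_{g_w})_{g\in\mathcal G},(j_l)_{l\in\mathcal L}\big)$ with $j_{g_d},j_{g_w}\in\{1,2\}$ and $j_l\in\{1,2,3\}$. For each such $k$, the vector $\boldsymbol a_k(\boldsymbol x)\in\mathbb R^{W+L}$ and scalar $b_k(\boldsymbol x)$ are defined by requiring, for all $\boldsymbol\xi$, $$\boldsymbol a_k(\boldsymbol x)^\top\boldsymbol\xi+b_k(\boldsymbol x)=\sum_{g}\big(A^{g_d}_{j_{g_d}}+A^{g_w}_{j_{g_w}}\big)+\sum_l A^l_{j_l},$$ where - $A^{g_d}_1=\beta_d\big(\alpha_g\sum_w(p_w-\tilde p_w)-r_g^+\big)$, $A^{g_d}_2=0$; - $A^{g_w}_1=\beta_w\big(\alpha_g\sum_w(\tilde p_w-p_w)-r_g^-\big)$,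 $A^{g_w}_2=0$; - $A^l_1=\beta_l\big(F_l(\boldsymbol x,\boldsymbol\xi)-\tilde p_l\big)$, $A^l_2=\beta_l\big(-F_l(\boldsymbol x,\boldsymbol\xi)-\tilde p_l\big)$, $A^l_3=0$. The functions $\boldsymbol a_k$ and $b_k$ are affine in $\boldsymbol x$, and $\Psi(\boldsymbol x,\boldsymbol\xi)=\max_{k}\big(\boldsymbol a_k(\boldsymbol x)^\top\boldsymbol\xi+b_k(\boldsymbol x)\big)$. Ambiguity set. $\hat{\boldsymbol\xi}^1,\dots,\hat{\boldsymbol\xi}^N\in\mathbb R^{W+L}$ ($N\ge1$) are given samples, $\nu=\frac1N\sum_{n=1}^N\delta_{\hat{\boldsymbol\xi}^n}$ is the empirical distribution, and $\hat{\boldsymbol m}=\frac1N\sum_n\hat{\boldsymbol\xi}^n$ and $\hat{\boldsymbol\Sigma}=\frac1N\sum_n(\hat{\boldsymbol\xi}^n-\hat{\boldsymbol m})(\hat{\boldsymbol\xi}^n-\hat{\boldsymbol m})^\top$ are its mean and covariance. Let $\theta>0$ and $\tau\ge1$ be given, let $\|\cdot\|$ be a norm on $\mathbb R^{W+L}$ with dual norm $\|\cdot\|_*$, and let $\mathcal P$ be the set of all Borel probability distributions on $\mathbb R^{W+L}$. The order-1 Wasserstein distance is $\Theta(\mu,\nu)=\min_\gamma\int\|\boldsymbol\xi-\boldsymbol\zeta\|\,\gamma(d\boldsymbol\xi,d\boldsymbol\zeta)$, over joint distributions $\gamma$ on $\mathbb R^{W+L}\times\mathbb R^{W+L}$ with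 marginals $\mu$ and $\nu$. Define $$\mathcal M_1=\{\mu\in\mathcal P:\Theta(\mu,\nu)\le\theta\},\qquad \mathcal M_2=\{\mu\in\mathcal P:\mathbb E_\mu[(\boldsymbol\xi-\hat{\boldsymbol m})(\boldsymbol\xi-\hat{\boldsymbol m})^\top]\preceq\tau\hat{\boldsymbol\Sigma}\},\qquad \mathcal M=\mathcal M_1\cap\mathcal M_2.$$ Here $\preceq$ denotes the Loewner (positive semidefinite) order on symmetric matrices. ''Max'' and ''min'' in the optimization problems are understood as supremum and infimum. *)

(* Defs.v *)
From HB Require Import structures.
From mathcomp Require Import all_boot all_order all_algebra.
From mathcomp Require Import all_classical all_reals all_analysis.

Set Implicit Arguments.
Unset Strict Implicit.
Unset Printing Implicit Defensive.

Import Order.TTheory GRing.Theory Num.Theory.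
Import numFieldNormedType.Exports.

Local Open Scope classical_set_scope.
Local Open Scope ring_scope.

(** * Vectors, norms, the Loewner order *)

Definition dot (R : realType) (n : nat) (u v : 'cV[R]_n) : R :=
  (u^T *m v) ord0 ord0.

Record is_norm (R : realType) (n : nat) (nm : 'cV[R]_n -> R) : Prop := IsNorm {
  norm_triangle : forall u v, nm (u + v) <= nm u + nm v;
  norm_homog : forall (c : R) u, nm (c *: u) = `|c| * nm u;
  norm_definite : forall u, nm u = 0 -> u = 0 }.

(* In finite dimension the set below is nonempty and bounded above, so that
   the real supremum is the genuine one. *)
Definition dual_norm (R : realType) (n : nat) (nm : 'cV[R]_n -> R)
    (z : 'cV[R]_n) : R :=
  sup [set dot z u | u in [set u | nm u <= 1]].

Definition psd (R : realType) (n : nat) (A : 'M[R]_n) : Prop :=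
  A^T = A /\ forall v : 'cV[R]_n, 0 <= dot v (A *m v).

Definition loewner_le (R : realType) (n : nat) (A B : 'M[R]_n) : Prop :=
  psd (B - A).

Definition strictly_convex_quadratic (R : realType) (f : R -> R) : Prop :=
  (exists a b c : R, forall t, f t = a * t ^+ 2 + b * t + c) /\
  (forall s t u : R, s != t -> 0 < u -> u < 1 ->
     f (u * s + (1 - u) * t) < u * f s + (1 - u) * f t).

(** * Probability on R^n *)

(* R^n with its Borel sigma-algebra. *)
Definition borel_vec (R : realType) (n : nat) :=
  g_sigma_algebraType (@open 'cV[R]_n).

Section Measures.
Variables (R : realType) (n : nat).
Local Notation T := (borel_vec R n).

Section Empirical.
Variables (N : nat) (xi : 'I_N -> 'cV[R]_n).

(* [msum] sums an infinite sequence of measures up to rank N, hence the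
   padding by the zero measure. *)
Definition empirical : {measure set T -> \bar R} :=
  mscale (N%:R^-1)%:nng
    (msum (fun i : nat =>
       if insub i is Some j then dirac (xi j : T) else mzero) N).

Lemma empiricalE (A : set T) :
  empirical A = ((N%:R^-1)%:E * \sum_(i < N) dirac (xi i : T) A)%E.
Proof.
rewrite /empirical /= /mscale /= /msum; congr (_ * _)%E.
by apply: eq_bigr => i _; rewrite valK.
Qed.

Lemma empirical_setT : (0 < N)%N -> empirical setT = 1%E.
Proof.
move=> N0; rewrite empiricalE.
under eq_bigr do rewrite diracT.
rewrite sumEFin -EFinM big_const_ord iter_addr_0.
by rewrite mulVf // pnatr_eq0 -lt0n.
Qed.

Definition sample_mean : 'cV[R]_n := N%:R^-1 *: \sum_(i < N) xi i.

Definition sample_cov : 'M[R]_n :=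
  N%:R^-1 *: \sum_(i < N) (xi i - sample_mean) *m (xi i - sample_mean)^T.

End Empirical.

Definition is_coupling (mu nu : {measure set T -> \bar R})
    (gamma : probability (T * T)%type R) : Prop :=
  forall A : set T, measurable A ->
    gamma (fst @^-1` A) = mu A /\ gamma (snd @^-1` A) = nu A.

Definition wasserstein (nm : 'cV[R]_n -> R)
    (mu nu : {measure set T -> \bar R}) : \bar R :=
  ereal_inf [set (\int[gamma]_z (nm ((z.1 : 'cV[R]_n) - z.2))%:E)%E
            | gamma in is_coupling mu nu].

Definition dev_prod (m : 'cV[R]_n) (i j : 'I_n) (xi : T) : R :=
  ((xi : 'cV[R]_n) - m) i ord0 * ((xi : 'cV[R]_n) - m) j ord0.

Definition second_moment (mu : probability T R) (m : 'cV[R]_n) : 'M[R]_n :=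
  \matrix_(i, j) fine ('E_mu[dev_prod m i j])%E.

Definition wasserstein_ball (nm : 'cV[R]_n -> R) (N : nat)
    (xi : 'I_N -> 'cV[R]_n) (theta : R) : set (probability T R) :=
  [set mu : probability T R | (wasserstein nm mu (empirical xi) <= theta%:E)%E].

(* Integrability is required explicitly, since [fine] would turn an infinite
   or undefined second moment into a junk real number. *)
Definition moment_set (N : nat) (xi : 'I_N -> 'cV[R]_n) (tau : R) :
    set (probability T R) :=
  [set mu : probability T R |
    (forall i j, mu.-integrable setT (EFin \o dev_prod (sample_mean xi) i j)) /\
    loewner_le (second_moment mu (sample_mean xi)) (tau *: sample_cov xi)].

Definition ambiguity_set (nm : 'cV[R]_n -> R) (N : nat)
    (xi : 'I_N -> 'cV[R]_n) (theta tau : R) : set (probability T R) :=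
  wasserstein_ball nm xi theta `&` moment_set xi tau.

End Measures.

(** * The dispatch model *)

Record grid (R : realType) (gen load wind line : finType) := Grid {
  pmin : gen -> R;
  pmax : gen -> R;
  pwind : wind -> R;
  pload : load -> R;
  pline : line -> R;
  pi_gen : gen -> line -> R;
  pi_wind : wind -> line -> R;
  pi_load : load -> line -> R;
  beta_load : R;
  beta_wind : R;
  beta_line : R;
  cost_gen : gen -> R -> R;
  cost_up : gen -> R -> R;
  cost_down : gen -> R -> R }.

Record decision (R : realType) (gen : finType) := Decision {
  pgen : gen -> R;
  rup : gen -> R;
  rdown : gen -> R;
  alpha : gen -> R }.

(* A tuple ((j_gd)_g, (j_gw)_g, (j_l)_l); the values 0, 1, 2 stand for the
   customary indices 1, 2, 3. *)
Definition piece_index (gen line : finType) : finType :=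
  ({ffun gen -> 'I_2} * {ffun gen -> 'I_2} * {ffun line -> 'I_3})%type.

Lemma card_piece_index (gen line : finType) :
  #|piece_index gen line| = (4 ^ #|gen| * 3 ^ #|line|)%N.
Proof. by rewrite !card_prod !card_ffun !card_ord -expnMn. Qed.

Section Model.
Variables (R : realType) (gen load wind line : finType).
Variable D : grid R gen load wind line.
Implicit Types (x : decision R gen) (k : piece_index gen line).

Local Notation dim := (#|wind| + #|line|)%N.
Implicit Types xi : 'cV[R]_dim.

Definition cost x : R :=
  \sum_g (cost_gen D g (pgen x g) + cost_up D g (rup x g)
          + cost_down D g (rdown x g)).

(* The polyhedron A x <= h. *)
Record feasible x : Prop := Feasible {
  balance :
    \sum_g pgen x g + \sum_w pwind D w - \sum_d pload D d = 0;
  line_limit : forall l,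
    `| \sum_g pi_gen D g l * pgen x g + \sum_w pi_wind D w l * pwind D w
       - \sum_d pi_load D d l * pload D d | <= pline D l;
  gen_limit : forall g, pmin D g <= pgen x g <= pmax D g;
  rup_limit : forall g, 0 <= rup x g <= pmax D g - pgen x g;
  rdown_limit : forall g, 0 <= rdown x g <= pgen x g - pmin D g;
  alpha_limit : forall g, 0 <= alpha x g <= 1;
  alpha_sum : \sum_g alpha x g = 1 }.

(* The first #|wind| coordinates of the random vector are the wind outputs,
   the last #|line| ones the line capacities. *)
Definition rwind xi (w : wind) : R := xi (lshift #|line| (enum_rank w)) ord0.
Definition rline xi (l : line) : R := xi (rshift #|wind| (enum_rank l)) ord0.

Definition shed x xi (g : gen) : R :=
  alpha x g * \sum_w (pwind D w - rwind xi w) - rup x g.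

Definition curtail x xi (g : gen) : R :=
  alpha x g * \sum_w (rwind xi w - pwind D w) - rdown x g.

Definition flow x xi (l : line) : R :=
  \sum_g pi_gen D g l * (pgen x g
                         + alpha x g * \sum_w (pwind D w - rwind xi w))
  + \sum_w pi_wind D w l * rwind xi w - \sum_d pi_load D d l * pload D d.

Definition Psi x xi : R :=
  beta_load D * \sum_g Num.max (shed x xi g) 0
  + beta_wind D * \sum_g Num.max (curtail x xi g) 0
  + beta_line D * \sum_l Num.max (`|flow x xi l| - rline xi l) 0.

Definition A_load x xi (g : gen) (j : 'I_2) : R :=
  if val j is 0%N then beta_load D * shed x xi g else 0.

Definition A_wind x xi (g : gen) (j : 'I_2) : R :=
  if val j is 0%N then beta_wind D * curtail x xi g else 0.

Definition A_line x xi (l : line) (j : 'I_3) : R :=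
  match val j with
  | 0%N => beta_line D * (flow x xi l - rline xi l)
  | 1%N => beta_line D * (- flow x xi l - rline xi l)
  | _ => 0
  end.

Definition piece k x xi : R :=
  \sum_g (A_load x xi g (k.1.1 g) + A_wind x xi g (k.1.2 g))
  + \sum_l A_line x xi l (k.2 l).

(* The intercept and the slope of the affine map [piece k x]; they are the
   only ones satisfying [piece_affine] below. *)
Definition b_ k x : R := piece k x 0.
Definition a_ k x : 'cV[R]_dim :=
  \col_i (piece k x (delta_mx i ord0) - piece k x 0).

Let affine (h : 'cV[R]_dim -> R) :=
  forall (c : R) u v, h (c *: u + v) - h 0 = c * (h u - h 0) + (h v - h 0).

Let affine_cst (c : R) : affine (fun=> c).
Proof. by move=> ? u v; rewrite !subrr mulr0 addr0. Qed.

Let affineD h1 h2 : affine h1 -> affine h2 -> affine (fun u => h1 u + h2 u).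
Proof.
move=> a1 a2 c u v; have := a1 c u v; have := a2 c u v.
move=> e2 e1; rewrite !opprD !(addrACA _ _ (- h1 0)) e1 e2.
by rewrite [LHS]addrACA -mulrDr.
Qed.

Let affineM (r : R) h : affine h -> affine (fun u => r * h u).
Proof. by move=> a1 c u v; rewrite -!mulrBr a1 mulrDr mulrCA. Qed.

Let affineN h : affine h -> affine (fun u => - h u).
Proof.
move=> /(affineM (-1)) a1 c u v; have := a1 c u v.
by rewrite !mulN1r.
Qed.

Let affine_sum (I : finType) (h : I -> 'cV[R]_dim -> R) :
  (forall i, affine (h i)) -> affine (fun u => \sum_i h i u).
Proof.
move=> a1 c u v; rewrite -!sumrB mulr_sumr -big_split /=.
by apply: eq_bigr => i _; exact: a1.
Qed.

Let affine_coord i : affine (fun u => u i ord0).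
Proof. by move=> c u v; rewrite !mxE !subr0. Qed.

Let affine_flow x l : affine (fun xi => flow x xi l).
Proof.
apply: affineD; last exact: affine_cst.
apply: affineD; last first.
  by apply: affine_sum => w; apply: affineM; exact: affine_coord.
apply: affine_sum => g; apply: affineM; apply: affineD; first exact: affine_cst.
apply: affineM; apply: affine_sum => w; apply: affineD; first exact: affine_cst.
exact/affineN/affine_coord.
Qed.

Let affine_piece k x : affine (piece k x).
Proof.
apply: affineD.
  apply: affine_sum => g.
  apply: affineD; rewrite /A_load /A_wind.
    case: (val _) => [|_]; last exact: affine_cst.
    apply: affineM; apply: affineD; last exact: affine_cst.
    apply: affineM; apply: affine_sum => w.
    by apply: affineD; [exact: affine_cst | exact/affineN/affine_coord].
  case: (val _) => [|_]; last exact: affine_cst.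
  apply: affineM; apply: affineD; last exact: affine_cst.
  apply: affineM; apply: affine_sum => w.
  by apply: affineD; [exact: affine_coord | exact: affine_cst].
apply: affine_sum => l; rewrite /A_line; case: (val _) => [|[|_]]; last exact: affine_cst.
  apply: affineM; apply: affineD; [exact: affine_flow|].
  exact/affineN/affine_coord.
apply: affineM; apply: affineD; [exact/affineN/affine_flow|].
exact/affineN/affine_coord.
Qed.

Lemma piece_affine k x xi : dot (a_ k x) xi + b_ k x = piece k x xi.
Proof.
suff e (s : seq 'I_dim) :
    piece k x (\sum_(i <- s) xi i ord0 *: delta_mx i ord0) - piece k x 0
    = \sum_(i <- s) a_ k x i ord0 * xi i ord0.
  apply/eqP; rewrite eq_sym -subr_eq; apply/eqP.
  rewrite /dot mxE; under eq_bigr do rewrite mxE.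
  rewrite -e; congr (piece k x _ - _).
  apply/colP => i; rewrite summxE (bigD1 i) //= !mxE !eqxx mulr1.
  rewrite big1 ?addr0 // => j ji.
  by rewrite !mxE eq_sym (negbTE ji) mulr0.
elim: s => [|i s IH]; first by rewrite !big_nil subrr.
by rewrite !big_cons affine_piece IH !mxE mulrC.
Qed.

Section Reformulation.
Variables (nm : 'cV[R]_dim -> R) (N : nat) (xihat : 'I_N -> 'cV[R]_dim).
Variables (theta tau : R).

Definition worst_case x : \bar R :=
  ereal_sup [set ('E_mu[Psi x])%E | mu in ambiguity_set nm xihat theta tau].

Definition dro_objective x : \bar R := ((cost x)%:E + worst_case x)%E.

Local Notation mhat := (sample_mean xihat).

Definition lmi_offdiag k x (z : 'cV[R]_dim) (Gam : 'M[R]_dim) : 'cV[R]_dim :=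
  - (2^-1 *: a_ k x) + 2^-1 *: z - Gam *m mhat.

Definition lmi_corner k x (n : 'I_N) (yn : R) (z : 'cV[R]_dim)
    (Gam : 'M[R]_dim) : R :=
  yn - b_ k x - dot z (xihat n) + dot mhat (Gam *m mhat).

Definition lmi k x n yn z Gam : 'M[R]_(dim + 1) :=
  block_mx Gam (lmi_offdiag k x z Gam)
           (lmi_offdiag k x z Gam)^T (lmi_corner k x n yn z Gam)%:M.

Record conic_feasible x (y : 'I_N -> R)
    (zeta : 'I_N -> piece_index gen line -> 'cV[R]_dim)
    (lam : R) (Gam : 'M[R]_dim) : Prop := ConicFeasible {
  lam_ge0 : 0 <= lam;
  Gam_psd : psd Gam;
  lmi_psd : forall k n, psd (lmi k x n (y n) (zeta n k) Gam);
  dual_norm_le : forall k n, dual_norm nm (zeta n k) <= lam;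
  conic_x : feasible x }.

Definition conic_objective x (y : 'I_N -> R) (lam : R) (Gam : 'M[R]_dim) : R :=
  cost x + lam * theta + tau * \tr (Gam *m sample_cov xihat)
  + N%:R^-1 * \sum_n y n.

End Reformulation.

End Model.

(* Main.v *)
Require Import Defs.
From HB Require Import structures.
From mathcomp Require Import all_boot all_order all_algebra.
From mathcomp Require Import all_classical all_reals all_analysis.
From mathcomp Require Import measurable_realfun.
From mathcomp Require Import ring lra.

Set Implicit Arguments.
Unset Strict Implicit.
Unset Printing Implicit Defensive.

Import Order.TTheory GRing.Theory Num.Theory.
Import numFieldNormedType.Exports.

Local Open Scope classical_set_scope.
Local Open Scope ring_scope.

(* Weak duality: integrate the dual inequality against a near-optimal coupling
   of [mu] with the empirical measure; the moment constraint enters through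
   [0 <= tr (G (tau Sigma - M))], a trace of a product of semidefinite matrices.

   Strong duality: on finite mixtures of assignments sample -> point, a
   hyperplane supporting the convex set of attainable (cost, moment, - value)
   triples yields the multipliers [lam] and [G]. Slater's condition may fail
   because the empirical covariance can be singular, so the plans are confined
   to the affine hull of the samples, where contracting the samples towards
   their mean gives a Slater point. The pointwise dual inequality is then
   carried to the whole space by adding to [G] a large multiple of a form that
   vanishes on the hull: it costs nothing in the objective and absorbs the
   Lipschitz penalty function at an arbitrarily small price. Finally, a
   subgradient argument turns the norm term into the variables [zeta]. *)

(** * Supporting hyperplanes of convex sets *)

Definition sublinear (R : realType) (V : lmodType R) (f : V -> R) : Prop :=
  (forall u v, f (u + v) <= f u + f v) /\
  (forall c u, 0 < c -> f (c *: u) <= c * f u).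

Section HahnBanach.
Variable R : realType.

Section Sublinear.
Variable V : lmodType R.
Implicit Types (f : V -> R) (e u v : V).

Lemma sublinear0 f : sublinear f -> f 0 = 0.
Proof.
move=> [fD fZ]; have := fD 0 0; have := fZ 2^-1 0.
rewrite addr0 scaler0 invr_gt0 ltr0n => /(_ isT); lra.
Qed.

Lemma sublinearZ f c u : sublinear f -> 0 <= c -> f (c *: u) = c * f u.
Proof.
move=> sf; rewrite le_eqVlt => /predU1P[<-|c0].
  by rewrite scale0r mul0r sublinear0.
apply/eqP; rewrite eq_le sf.2//= -ler_pdivlMl//.
rewrite -{1}[u]scale1r -(mulVf (lt0r_neq0 c0)) -scalerA.
by apply: sf.2; rewrite invr_gt0.
Qed.

Lemma sublinear_ge_opp f u : sublinear f -> - f (- u) <= f u.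
Proof. by move=> sf; have := sf.1 u (- u); rewrite subrr sublinear0//; lra. Qed.

(* The infimum of [f (u + t e) - t f e] over [t >= 0] is the largest sublinear
   minorant of [f] whose value at [- e] is at most [- f e]. *)
Lemma sublinear_straighten f e : sublinear f ->
  exists g, [/\ sublinear g, forall u, g u <= f u & g e + g (- e) <= 0].
Proof.
move=> sf.
pose A u := [set f (u + t *: e) - t * f e | t in [set t | 0 <= t]].
have lbA u : lbound (A u) (- f (- u)).
  move=> _ [t /= t0 <-]; have := sf.1 (u + t *: e) (- u).
  by rewrite addrAC subrr add0r sublinearZ//; lra.
have A0 u : A u !=set0 by exists (f (u + 0 *: e) - 0 * f e), 0 => /=.
have infA u t : 0 <= t -> inf (A u) <= f (u + t *: e) - t * f e.
  by move=> t0; apply: ge_inf; [exists (- f (- u))|exists t].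
exists (fun u => inf (A u)); split.
- split=> [u v|c u c0].
    rewrite -lerBlDr; apply: lb_le_inf => // _ [s /= s0 <-].
    rewrite lerBlDr -lerBlDl; apply: lb_le_inf => // _ [t /= t0 <-].
    rewrite lerBlDl; apply: (le_trans (infA _ (s + t) (addr_ge0 s0 t0))).
    have := sf.1 (u + s *: e) (v + t *: e).
    by rewrite addrACA -scalerDl mulrDl; lra.
  rewrite -ler_pdivrMl//; apply: lb_le_inf => // _ [t /= t0 <-].
  rewrite ler_pdivrMl//; apply: (le_trans (infA _ (c * t) _)).
    exact: mulr_ge0 (ltW c0) t0.
  by rewrite -scalerA -scalerDr sublinearZ// ?(ltW c0)// mulrBr mulrA.
- by move=> u; have := infA u 0 (lexx 0); rewrite scale0r addr0 mul0r subr0.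
have := infA e 0 (lexx 0); have := infA (- e) 1 ler01.
by rewrite scale0r scale1r addNr addr0 sublinear0//; lra.
Qed.

(** Later rounds pass to smaller functions, so the inequality gained at an earlier vector
    persists. *)
Lemma sublinear_straighten_seq f (s : seq V) : sublinear f ->
  exists g, [/\ sublinear g, forall u, g u <= f u &
                forall e, e \in s -> g e + g (- e) <= 0].
Proof.
move=> sf; elim: s => [|e s [g [sg gf gs]]]; first by exists f.
have [h [sh hg he]] := sublinear_straighten e sg.
exists h; split=> // [u|e']; first exact: le_trans (hg u) (gf u).
rewrite inE => /predU1P[->//|/gs]; apply: le_trans.
exact: lerD.
Qed.

End Sublinear.

(** Straightening along a basis makes [g] linear on each basis line. The linear [l] with the same
    values on the basis dominates [g] by subadditivity, and this bound at [- u] gives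
    [l u <= g u <= f u]. *)
Lemma hahn_banach (V : vectType R) (f : V -> R) : sublinear f ->
  exists l : V -> R, [/\ forall u v, l (u + v) = l u + l v,
    forall c u, l (c *: u) = c * l u & forall u, l u <= f u].
Proof.
move=> sf; have [g [sg gf gl]] := sublinear_straighten_seq (vbasis fullv) sf.
pose l (u : V) := \sum_i coord (vbasis fullv) i u * g (vbasis fullv)`_i.
have gsum (I : Type) (r : seq I) (F : I -> V) :
    g (\sum_(i <- r) F i) <= \sum_(i <- r) g (F i).
  elim: r => [|i r IH]; first by rewrite !big_nil sublinear0.
  by rewrite !big_cons (le_trans (sg.1 _ _))// lerD2l.
have gZ c (i : 'I_(\dim (@fullv R V))) :
    g (c *: (vbasis fullv)`_i) <= c * g (vbasis fullv)`_i.
  have [c0|c0] := leP 0 c; first by rewrite sublinearZ.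
  have : (vbasis fullv)`_i \in (vbasis (@fullv R V) : seq V).
    by apply: mem_nth; rewrite size_tuple.
  rewrite -[c in c *: _]opprK scaleNr -scalerN sublinearZ//; last first.
    by rewrite oppr_ge0 ltW.
  by move=> /gl /(mulr_le0 (ltW c0)); lra.
have gl_le u : g u <= l u.
  rewrite {1}(coord_vbasis (memvf u)) (le_trans (gsum _ _ _))//.
  by apply: ler_sum => i _.
exists l; split=> [u v|c u|u].
- by rewrite -big_split; apply: eq_bigr => i _; rewrite linearD mulrDl.
- by rewrite mulr_sumr; apply: eq_bigr => i _; rewrite linearZ mulrA.
apply: le_trans (gf u); have := sublinear_ge_opp u sg; apply: le_trans.
rewrite lerNr (le_trans (gl_le _))//.
by rewrite -sumrN; apply: ler_sum => i _; rewrite linearN mulNr.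
Qed.

(* A supporting hyperplane at the bottom of the fibre over [0], which lies in
   the algebraic interior of the projection of the convex set [A]. *)
Lemma convex_support (V : vectType R) (A : V -> R -> Prop) (p : R) :
  (forall u i v j s t, A u i -> A v j -> 0 < s -> 0 < t -> s + t = 1 ->
     A (s *: u + t *: v) (s * i + t * j)) ->
  (forall u, exists t j, 0 < t /\ A (t *: u) j) ->
  (forall j, A 0 j -> p <= j) ->
  exists l : V -> R, [/\ forall u v, l (u + v) = l u + l v,
    forall c u, l (c *: u) = c * l u & forall u j, A u j -> p + l u <= j].
Proof.
move=> Acvx Acore Ap.
(* Slopes from the point [(0, p)] to the points of [A] over the ray through [u]; their infimum is
   the sublinear function handed to [hahn_banach]. *)
pose B u := [set r | exists t j, [/\ 0 < t, A (t *: u) j & r = (j - p) / t]].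
have B0 u : B u !=set0.
  by have [t [j [t0 Aj]]] := Acore u; exists ((j - p) / t), t, j.
(* The weights make the two points contribute the same multiple of [u] and of [v]. *)
have mix u v s t i j : 0 < s -> 0 < t -> A (s *: u) i -> A (t *: v) j ->
    A ((s * t / (s + t)) *: (u + v)) ((t * i + s * j) / (s + t)).
  move=> s0 t0 Ai Aj; have st0 : 0 < s + t by rewrite addr_gt0.
  have := Acvx _ _ _ _ (t / (s + t)) (s / (s + t)) Ai Aj.
  rewrite !divr_gt0// => /(_ isT isT).
  rewrite !scalerA [s * t / _]mulrAC [t / _ * s]mulrAC [t * s]mulrC.
  rewrite [s * t / (_)]mulrAC -scalerDr => H.
  have -> : (t * i + s * j) / (s + t) = t / (s + t) * i + s / (s + t) * j.
    by field; rewrite lt0r_neq0.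
  by apply: H; field; rewrite lt0r_neq0.
(* Mixing with a point over the opposite ray lands in the fibre over [0], where [p] is a lower
   bound. *)
have lbB u : exists m, lbound (B u) m.
  have [s [i [s0 Ai]]] := Acore (- u).
  exists (- ((i - p) / s)) => _ [t [j [t0 Aj ->]]].
  have := Ap _; have := mix _ _ _ _ _ _ s0 t0 Ai Aj.
  rewrite addNr scaler0 => /[swap] /[apply].
  rewrite ler_pdivlMr ?addr_gt0// => H.
  rewrite -subr_ge0 opprK.
  have -> : (j - p) / t + (i - p) / s = (t * i + s * j - p * (s + t)) / (s * t).
    by field; rewrite !lt0r_neq0.
  by rewrite divr_ge0 ?subr_ge0// mulr_ge0 ?ltW.
have infB u t j : 0 < t -> A (t *: u) j -> inf (B u) <= (j - p) / t.
  by move=> t0 Aj; apply: ge_inf; [exact: lbB|exists t, j].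
have [|l [lD lZ lB]] := @hahn_banach V (fun u => inf (B u)).
  split=> [u v|c u c0].
    rewrite -lerBlDr; apply: lb_le_inf => // _ [s [i [s0 Ai ->]]].
    rewrite lerBlDr -lerBlDl; apply: lb_le_inf => // _ [t [j [t0 Aj ->]]].
    rewrite lerBlDl; apply: le_trans (infB _ _ _ _ (mix _ _ _ _ _ _ s0 t0 Ai Aj)) _.
      by rewrite divr_gt0 ?mulr_gt0 ?addr_gt0.
    rewrite le_eqVlt; apply/orP; left; apply/eqP; field.
    by rewrite !lt0r_neq0// addr_gt0.
  rewrite -ler_pdivrMl//; apply: lb_le_inf => // _ [t [j [t0 Aj ->]]].
  rewrite ler_pdivrMl//; have -> : c * ((j - p) / t) = (j - p) / (t / c).
    by field; rewrite !lt0r_neq0.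
  by apply: infB; rewrite ?divr_gt0// scalerA divfK// lt0r_neq0.
exists l; split=> // u j Aj.
have := le_trans (lB u) (infB u 1 j ltr01 _); rewrite scale1r divr1.
by move=> /(_ Aj); lra.
Qed.

End HahnBanach.

(** * Dot product and norms *)

Section Dot.
Variables (R : realType) (n : nat).
Implicit Types (u v w : 'cV[R]_n) (A B : 'M[R]_n).

Lemma dotE u v : dot u v = \sum_i u i ord0 * v i ord0.
Proof. by rewrite /dot mxE; apply: eq_bigr => i _; rewrite mxE. Qed.

Lemma dotC u v : dot u v = dot v u.
Proof. by rewrite !dotE; apply: eq_bigr => i _; rewrite mulrC. Qed.

Lemma dotDr u v w : dot u (v + w) = dot u v + dot u w.
Proof. by rewrite /dot mulmxDr mxE. Qed.

Lemma dotZr c u v : dot u (c *: v) = c * dot u v.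
Proof. by rewrite /dot -scalemxAr mxE. Qed.

Lemma dotNr u v : dot u (- v) = - dot u v.
Proof. by rewrite /dot mulmxN mxE. Qed.

Lemma dotDl u v w : dot (u + v) w = dot u w + dot v w.
Proof. by rewrite !(dotC _ w) dotDr. Qed.

Lemma dotZl c u v : dot (c *: u) v = c * dot u v.
Proof. by rewrite !(dotC _ v) dotZr. Qed.

Lemma dotNl u v : dot (- u) v = - dot u v.
Proof. by rewrite !(dotC _ v) dotNr. Qed.

Lemma dot0r u : dot u 0 = 0.
Proof. by rewrite /dot mulmx0 mxE. Qed.

Lemma dot_ge0 u : 0 <= dot u u.
Proof. by rewrite dotE sumr_ge0// => i _; rewrite -expr2 sqr_ge0. Qed.

Lemma dot_mulmxE u A v :
  dot u (A *m v) = \sum_i \sum_j A i j * (u i ord0 * v j ord0).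
Proof.
rewrite dotE; apply: eq_bigr => i _; rewrite mxE mulr_sumr.
by apply: eq_bigr => j _; rewrite mulrCA.
Qed.

Lemma mxtrace_mulmxE A B : \tr (A *m B) = \sum_i \sum_j A i j * B j i.
Proof. by apply: eq_bigr => i _; rewrite mxE. Qed.

End Dot.

Lemma cV_sum_delta (R : realType) (n : nat) (u : 'cV[R]_n) :
  u = \sum_i u i ord0 *: delta_mx i ord0.
Proof.
by rewrite {1}[u]matrix_sum_delta; apply: eq_bigr => i _; rewrite big_ord1.
Qed.

Lemma dot_mulmxl (R : realType) (m n : nat) (A : 'M[R]_(m, n)) u v :
  dot (A *m u) v = dot u (A^T *m v).
Proof. by rewrite /dot trmx_mul mulmxA. Qed.

Section Norm.
Variables (R : realType) (n : nat) (nm : 'cV[R]_n -> R).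
Hypothesis nmP : is_norm nm.
Implicit Types u v : 'cV[R]_n.

Lemma is_norm0 : nm 0 = 0.
Proof. by rewrite -(scale0r 0) (norm_homog nmP) normr0 mul0r. Qed.

Lemma is_normN u : nm (- u) = nm u.
Proof. by rewrite -scaleN1r (norm_homog nmP) normrN normr1 mul1r. Qed.

Lemma is_norm_ge0 u : 0 <= nm u.
Proof.
by have := norm_triangle nmP u (- u); rewrite subrr is_norm0 is_normN; lra.
Qed.

Lemma is_norm_le_coord u :
  nm u <= \sum_i `|u i ord0| * nm (delta_mx i ord0).
Proof.
have nmZ i : `|u i ord0| * nm (delta_mx i ord0) = nm (u i ord0 *: delta_mx i ord0).
  by rewrite (norm_homog nmP).
rewrite {1}[u]cV_sum_delta; under [leRHS]eq_bigr do rewrite nmZ.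
elim: index_enum => [|i r IH]; first by rewrite !big_nil is_norm0.
by rewrite !big_cons (le_trans (norm_triangle nmP _ _))// lerD2l.
Qed.

(** Equivalence of norms: [nm] is continuous and positive on the unit sphere of the sup norm, which
    is compact, and [C] is the inverse of its minimum there. *)
Lemma is_norm_ge_coord :
  exists2 C, 0 <= C & forall u i, `|u i ord0| <= C * nm u.
Proof.
pose S := [set v : 'rV[R]_n | `|v| = 1].
have [S0|/eqP/set0P Sn0] := pselect (S = set0).
  exists 0 => // u i; rewrite mul0r.
  suff -> : u = 0 by rewrite mxE normr0.
  apply: trmx_inj; rewrite trmx0; apply/eqP; apply: contrapT => /negP u0.
  have : S (`|u^T|^-1 *: u^T).
    by rewrite /S /= normrZ normfV normr_id mulVf// normr_eq0.
  by rewrite S0.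
pose K := \sum_i nm (delta_mx i ord0).
have K0 : 0 <= K by apply: sumr_ge0 => i _; exact: is_norm_ge0.
have coord_le (v : 'rV[R]_n) i : `|v ord0 i| <= `|v|.
  rewrite -[leRHS]/(mx_norm v) mx_normrE.
  exact: (le_bigmax _ (fun ij => `|v ij.1 ij.2|) (ord0, i)).
have nm_le (v : 'rV[R]_n) : nm v^T <= K * `|v|.
  apply: (le_trans (is_norm_le_coord _)); rewrite mulr_suml.
  apply: ler_sum => i _; rewrite mulrC ler_wpM2l ?is_norm_ge0// mxE.
  exact: coord_le.
have cont : continuous (fun v : 'rV[R]_n => nm v^T).
  move=> v; apply/(@cvgrPdist_le _ _ _ (nbhs v) (nbhs_filter v)) => e e0.
  have K1 : 0 < K + 1 by rewrite ltr_wpDl.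
  near=> w.
  have : nm (v - w)^T <= e.
    apply: (le_trans (nm_le _)).
    have vw : `|v - w| <= e / (K + 1).
      near: w; move: (@cvg_id _ (nbhs v)) => /cvgrPdist_le; apply.
      by rewrite divr_gt0.
    apply: (@le_trans _ _ ((K + 1) * `|v - w|)).
      by rewrite ler_wpM2r// lerDl.
    by rewrite mulrC -ler_pdivlMr.
  have := norm_triangle nmP (v - w)^T w^T.
  have := norm_triangle nmP (w - v)^T v^T.
  rewrite -!linearD/= !subrK -(opprB v w) [X in nm X + _]linearN is_normN.
  by rewrite ler_norml; lra.
have cS : compact S.
  apply: bounded_closed_compact.
    by exists 1; split=> // M M1 v /= ->; exact: ltW.
  apply: (@preimage_closed _ _ (fun v : 'rV[R]_n => `|v|) [set 1]).
    by move=> v _; exact: norm_continuous.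
  exact: closed_eq.
have [c /set_mem cSc cmin] := EVT_min_rV Sn0 cS (continuous_subspaceT cont).
have c0 : 0 < nm c^T.
  rewrite lt_neqAle is_norm_ge0 andbT eq_sym; apply/eqP => /(norm_definite nmP).
  move=> /(congr1 trmx); rewrite trmxK trmx0 => c0.
  by move: cSc; rewrite /S/= c0 normr0 => /eqP; rewrite eq_sym oner_eq0.
exists (nm c^T)^-1; first by rewrite invr_ge0 ltW.
move=> u i; rewrite mulrC ler_pdivlMr//.
have [->|u0] := eqVneq u 0; first by rewrite mxE normr0 mul0r is_norm0.
have u0' : 0 < `|u^T| by rewrite normr_gt0 trmx_eq0.
apply: (@le_trans _ _ (`|u^T| * nm c^T)).
  by rewrite ler_wpM2r ?is_norm_ge0//; have := coord_le u^T i; rewrite mxE.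
rewrite -ler_pdivlMl//.
have := cmin (`|u^T|^-1 *: u^T); rewrite linearZ/= trmxK (norm_homog nmP).
rewrite ger0_norm ?invr_ge0 ?(ltW u0')//; apply.
by apply/mem_set; rewrite /S/= normrZ normfV normr_id mulVf// normr_eq0 trmx_eq0.
Unshelve. all: by end_near. Qed.

(** The real supremum in [dual_norm] dominates its set only once that set is known to be bounded;
    the coordinate estimate provides this. *)
Lemma dual_normP z u : dot z u <= dual_norm nm z * nm u.
Proof.
have [C C0 HC] := is_norm_ge_coord.
have ub : has_ubound [set dot z u | u in [set u | nm u <= 1]].
  exists (\sum_i `|z i ord0| * C) => _ [v /= v1 <-]; rewrite dotE.
  apply: ler_sum => i _; rewrite (le_trans (ler_norm _))// normrM.
  rewrite ler_wpM2l// (le_trans (HC v i))//.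
  by rewrite -[leRHS]mulr1 ler_wpM2l.
have [u0|u0] := eqVneq (nm u) 0.
  by rewrite (norm_definite nmP u0) dot0r is_norm0 mulr0.
have nu0 : 0 < nm u by rewrite lt_neqAle eq_sym u0 is_norm_ge0.
rewrite -ler_pdivrMr// mulrC -dotZr; apply: ub_le_sup => //.
exists ((nm u)^-1 *: u) => //=; rewrite (norm_homog nmP) ger0_norm.
  by rewrite mulVf.
by rewrite invr_ge0 ltW.
Qed.

Lemma dual_norm_le_bound z lam : 0 <= lam ->
  (forall u, dot z u <= lam * nm u) -> dual_norm nm z <= lam.
Proof.
move=> lam0 zlam; apply: ge_sup.
  by exists (dot z 0), 0 => //=; rewrite is_norm0 ler01.
move=> _ [u /= u1 <-]; apply: (le_trans (zlam u)).
by rewrite -[leRHS]mulr1 ler_wpM2l.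
Qed.

(* The minimax exchange [inf_xi max_zeta = max_zeta inf_xi] behind the dual
   variables [zeta]: a subgradient at [0] of
   [z |-> inf_xi q xi + lam ||xi - c + z||]. *)
Lemma norm_penalty_dual (q : 'cV[R]_n -> R) (lam : R) (c : 'cV[R]_n) :
  (forall u v s t, 0 < s -> 0 < t -> s + t = 1 ->
     q (s *: u + t *: v) <= s * q u + t * q v) ->
  0 <= lam -> (forall u, 0 <= q u + lam * nm (u - c)) ->
  exists z, (forall w, dot z w <= lam * nm w) /\
            (forall u, 0 <= q u + dot z (u - c)).
Proof.
move=> qcvx lam0 q0.
(* Up to attainment, the epigraph of the perturbed infimum
   [w |-> inf_u q u + lam * nm (u - c + w)]. *)
pose A w (j : R) := exists u, q u + lam * nm (u - c + w) <= j.
have [|||l [lD lZ lA]] := @convex_support R 'cV[R]_n A 0.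
- move=> w i w' j s t [u ui] [v vj] s0 t0 st1; exists (s *: u + t *: v).
  have -> : s *: u + t *: v - c + (s *: w + t *: w') =
            s *: (u - c + w) + t *: (v - c + w').
    rewrite -{1}[c]scale1r -st1 scalerDl opprD.
    by apply/colP => k; rewrite !mxE; ring.
  have := norm_triangle nmP (s *: (u - c + w)) (t *: (v - c + w')).
  rewrite !(norm_homog nmP) !gtr0_norm//.
  have := qcvx u v s t s0 t0 st1; nra.
- by move=> w; exists 1, (q c + lam * nm (c - c + 1 *: w)); split=> //; exists c.
- by move=> j [u]; rewrite addr0; apply: le_trans.
have lN u : l (- u) = - l u by rewrite -scaleN1r lZ mulN1r.
have lE w : l w = dot (\col_i l (delta_mx i ord0)) w.
  have l0 : l 0 = 0 by rewrite -(scale0r 0) lZ mul0r.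
  rewrite {1}[w]cV_sum_delta (big_morph l lD l0) dotE; apply: eq_bigr => i _.
  by rewrite lZ mxE mulrC.
exists (\col_i l (delta_mx i ord0)); split=> [w|u]; rewrite -lE.
  apply/ler_addgt0Pr => e e0.
  (* Evaluating at [s *: w] for this large [s] makes the constant [q c] negligible against
     [s * e]. *)
  pose s := (`|q c| + 1) / e.
  have s0 : 0 < s by rewrite divr_gt0// ltr_wpDl.
  have := lA (s *: w) _ (ex_intro _ c (lexx _)).
  rewrite lZ subrr !add0r (norm_homog nmP) gtr0_norm// => H.
  rewrite -(ler_pM2l s0) mulrDr (le_trans H)//.
  have -> : s * e = `|q c| + 1 by rewrite /s divfK ?lt0r_neq0.
  by have := ler_norm (q c); lra.
(* The shift [c - u] cancels the norm term. *)
have := lA (c - u) _ (ex_intro _ u (lexx _)).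
by rewrite addrA subrK subrr is_norm0 mulr0 addr0 add0r -(opprB u c) lN; lra.
Qed.

End Norm.

(** * Semidefinite matrices *)

Section Psd.
Variables (R : realType) (n : nat).
Implicit Types (u v : 'cV[R]_n) (A B : 'M[R]_n).

Lemma dot_sym_mulmx A u v : A^T = A -> dot u (A *m v) = dot v (A *m u).
Proof. by move=> As; rewrite dotC dot_mulmxl As. Qed.

Lemma quadD A u v : A^T = A ->
  dot (u + v) (A *m (u + v)) =
  dot u (A *m u) + 2 * dot u (A *m v) + dot v (A *m v).
Proof.
move=> As; rewrite mulmxDr !dotDl !dotDr (dot_sym_mulmx v u As); ring.
Qed.

Lemma quadZ A c u : dot (c *: u) (A *m (c *: u)) = c ^+ 2 * dot u (A *m u).
Proof. by rewrite -scalemxAr dotZl dotZr mulrA. Qed.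

Lemma psdT A : psd A -> A^T = A. Proof. by case. Qed.

Lemma psd_ge0 A v : psd A -> 0 <= dot v (A *m v). Proof. by case=> _; exact. Qed.

Lemma dot_delta u i : dot u (delta_mx i ord0) = u i ord0.
Proof.
rewrite dotE (bigD1 i)//= mxE !eqxx mulr1 big1 ?addr0// => j ji.
by rewrite mxE (negbTE ji) mulr0.
Qed.

Lemma dot_deltal u i : dot (delta_mx i ord0) u = u i ord0.
Proof. by rewrite dotC dot_delta. Qed.

Lemma mulmx_delta A i j : (A *m delta_mx i (ord0 : 'I_1)) j ord0 = A j i.
Proof.
rewrite mxE (bigD1 i)//= mxE !eqxx mulr1 big1 ?addr0// => k ki.
by rewrite mxE (negbTE ki) mulr0.
Qed.

(** Along [e_j + t e_i] the form is affine in [t], since its quadratic coefficient [A i i] vanishes;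
    being nonnegative for all [t], it has slope zero. *)
Lemma psd_diag0 A i : psd A -> A i i = 0 -> forall j, A i j = 0.
Proof.
move=> [As A0] Aii j.
have H t : 0 <= A j j + 2 * t * A i j.
  have := A0 (delta_mx j ord0 + t *: delta_mx i ord0).
  rewrite quadD// quadZ -scalemxAr dotZr !dot_deltal !mulmx_delta Aii.
  by rewrite -[in A j i]As mxE; lra.
have [//|Aij] := eqVneq (A i j) 0.
have := H (- (A j j + 1) / (2 * A i j)).
have -> : 2 * (- (A j j + 1) / (2 * A i j)) * A i j = - (A j j + 1).
  by field.
lra.
Qed.

Lemma dot_rank1 u v : dot v ((u *m u^T) *m v) = dot u v ^+ 2.
Proof.
by rewrite /dot !mulmxA -mulmxA mxE big_ord1 expr2; congr (_ * _); exact: dotC.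
Qed.

(* Gaussian elimination, one pivot at a time. *)
Lemma psd_rank1_sum A : psd A ->
  exists s : seq 'cV[R]_n, A = \sum_(v <- s) v *m v^T.
Proof.
(* Induction on the number [k] of leading rows that may be nonzero. *)
suff H k : forall A, psd A -> (forall i j : 'I_n, (k <= i)%N -> A i j = 0) ->
    exists s : seq 'cV[R]_n, A = \sum_(v <- s) v *m v^T.
  by move=> Ap; apply: (H n) => // i j; rewrite leqNgt ltn_ord.
elim: k => [|k IH] {}A Ap Ak.
  by exists [::]; rewrite big_nil; apply/matrixP => i j; rewrite mxE Ak.
have [nk|kn] := leqP n k.
  by apply: IH => // i j ki; have := ltn_ord i; rewrite ltnNge (leq_trans nk).
pose p := Ordinal kn.
have [a0|a0] := eqVneq (A p p) 0.
  apply: IH => // i j; rewrite leq_eqVlt => /predU1P[ki|]; last exact: Ak.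
  have <- : p = i by apply: val_inj.
  exact: psd_diag0.
have [As A0] := Ap.
have a_gt0 : 0 < A p p.
  rewrite lt_neqAle eq_sym a0/=.
  by have := A0 (delta_mx p ord0); rewrite dot_deltal mulmx_delta.
(* [c *m c^T] agrees with [A] on row and column [p]; subtracting it leaves the Schur complement of
   the pivot. *)
pose c := Num.sqrt (A p p)^-1 *: col p A.
have cE i j : (c *m c^T) i j = (A p p)^-1 * (A i p * A p j).
  rewrite mxE big_ord1 !mxE -[in A j p]As mxE.
  rewrite mulrACA -expr2 sqr_sqrtr// invr_ge0; exact: ltW.
have [||s sE] := IH (A - c *m c^T).
- split=> [|v]; first by rewrite linearB/= trmx_mul trmxK As.
  rewrite mulmxBl dotDr dotNr dot_rank1 dotZl exprMn sqr_sqrtr; last first.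
    by rewrite invr_ge0 ltW.
  rewrite colE dot_mulmxl As dot_deltal.
  (* The multiple of the pivot direction that minimises the form of [A] gives the value of the Schur
     complement at [v]. *)
  have := A0 (v + (- (A *m v) p ord0 / A p p) *: delta_mx p ord0).
  rewrite quadD// quadZ -scalemxAr dotZr (dot_sym_mulmx v (delta_mx p ord0) As).
  rewrite !dot_deltal.
  rewrite mulmx_delta; set x := dot v _; set y := (_ *m v) _ _.
  suff -> : x + 2 * (- y / A p p * y) + (- y / A p p) ^+ 2 * A p p
            = x - (A p p)^-1 * y ^+ 2 by [].
  by field.
- move=> i j ki; rewrite [LHS]mxE [X in _ + X]mxE cE.
  move: ki; rewrite leq_eqVlt => /predU1P[ki|ki]; last first.
    by rewrite !(Ak i)// mul0r mulr0 subrr.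
  have <- : p = i by apply: val_inj.
  by rewrite mulrA mulVf// mul1r subrr.
exists (c :: s); rewrite big_cons -sE addrC subrK//.
Qed.

(** Writing [A] as a sum of matrices [v *m v^T] turns the trace into a sum of values of the form of
    [B]. *)
Lemma psd_trace_ge0 A B : psd A -> psd B -> 0 <= \tr (A *m B).
Proof.
move=> /psd_rank1_sum[s ->] [Bs B0]; rewrite mulmx_suml raddf_sum/=.
apply: sumr_ge0 => v _; rewrite -mulmxA mxtrace_mulC trace_mx11 -mulmxA.
exact: B0.
Qed.

Lemma quad_trace A u : dot u (A *m u) = \tr (A *m (u *m u^T)).
Proof. by rewrite mulmxA mxtrace_mulC trace_mx11. Qed.

(** Homogenisation: at [(v, s)] with [s] nonzero the block form is [s ^+ 2] times the inhomogeneous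
    polynomial at [s^-1 *: v]; at [s = 0] it reduces to the form of [G]. *)
Lemma psd_block (G : 'M[R]_n) (h : 'cV[R]_n) (c : R) :
  psd G ->
  psd (block_mx G h h^T c%:M) <->
  forall u, 0 <= dot u (G *m u) + 2 * dot h u + c.
Proof.
move=> Gp.
have val v (s : R) : dot (col_mx v s%:M) (block_mx G h h^T c%:M *m col_mx v s%:M)
    = dot v (G *m v) + 2 * s * dot h v + s ^+ 2 * c.
  rewrite mul_block_col /dot tr_col_mx mul_row_col mulmxDr mulmxDr.
  rewrite !mul_mx_scalar -!scalemxAr !tr_scalar_mx !mul_scalar_mx.
  have mxD (X Y : 'M[R]_1) : (X + Y) ord0 ord0 = X ord0 ord0 + Y ord0 ord0.
    by rewrite mxE.
  have mxZ (a : R) (X : 'M[R]_1) : (a *: X) ord0 ord0 = a * X ord0 ord0.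
    by rewrite mxE.
  rewrite !mxD !mxZ -!/(dot _ _) (dotC v h) mxE eqxx mulr1n; ring.
split=> [[_ H] u|H].
  by have := H (col_mx u 1%:M); rewrite val expr1n mul1r mulr1.
split=> [|w].
  by rewrite tr_block_mx trmxK tr_scalar_mx (psdT Gp).
have -> : w = col_mx (usubmx w) ((dsubmx w) ord0 ord0)%:M.
  by rewrite -mx11_scalar vsubmxK.
set v := usubmx w; set s := dsubmx w _ _; rewrite val.
have [->|s0] := eqVneq s 0.
  by rewrite mulr0 mul0r addr0 expr0n mul0r addr0 psd_ge0.
have := H (s^-1 *: v); rewrite quadZ dotZr => H'.
have -> : dot v (G *m v) + 2 * s * dot h v + s ^+ 2 * c =
  s ^+ 2 * (s^-1 ^+ 2 * dot v (G *m v) + 2 * (s^-1 * dot h v) + c).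
  by field.
by rewrite mulr_ge0// sqr_ge0.
Qed.

End Psd.

(** * Borel functions and discrete measures *)

Section BorelVec.
Variables (R : realType) (n : nat).
Local Notation T := (borel_vec R n).

Lemma measurable_coord i : measurable_fun setT (fun u : T => (u : 'cV[R]_n) i ord0).
Proof.
apply: (@measurability _ _ _ _ setT _ _ (RGenOInfty.measurableE R)) => _ [_ [a ->] <-].
rewrite setTI; apply: sub_sigma_algebra.
have := @coord_continuous R n 1 i ord0.
by move=> /continuousP; apply; exact: interval_open.
Qed.

Lemma measurable_dot (z : 'cV[R]_n) : measurable_fun setT (fun u : T => dot z u).
Proof.
rewrite (_ : (fun u : T => dot z u) = 
    fun u : T => \sum_i z i ord0 * (u : 'cV[R]_n) i ord0).
  apply: measurable_sum => i; apply: measurable_funM => //.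
  exact: measurable_coord.
by apply/funext => u; rewrite dotE.
Qed.

Lemma measurable_singleton (a : 'cV[R]_n) : measurable ([set a] : set T).
Proof.
rewrite -[X in measurable X]setCK; apply: measurableC; apply: sub_sigma_algebra.
apply: closed_openC; apply: accessible_closed_set1.
exact/hausdorff_accessible/norm_hausdorff.
Qed.

Lemma measurable_bigmax d (S : measurableType d) (I : Type) (r : seq I)
    (f : I -> S -> R) :
  (forall i, measurable_fun setT (f i)) ->
  measurable_fun setT (fun x => \big[Num.max/0]_(i <- r) f i x).
Proof.
move=> mf; elim: r => [|i r IH].
  by under eq_fun do rewrite big_nil; exact: measurable_cst.
by under eq_fun do rewrite big_cons; exact: measurable_maxr.
Qed.

End BorelVec.

Section Discrete.
Import HBNNSimple.
Context d (T : measurableType d) (R : realType).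
Implicit Types s : seq (R * T).

(** The absolute value gives [mscale] a nonnegative factor; it disappears for the nonnegative
    weights considered below. *)
Fixpoint discrete s : {measure set T -> \bar R} :=
  if s is p :: s' then
    measure_add (mscale (`|p.1|)%:nng (dirac p.2)) (discrete s')
  else mzero.

Lemma discreteE s A : (forall p, p \in s -> 0 <= p.1) ->
  discrete s A = (\sum_(p <- s) p.1 * (\1_A p.2 : R))%:E.
Proof.
elim: s => [|p s IH] s0; first by rewrite big_nil.
rewrite [LHS](measure_addE (mscale (`|p.1|)%:nng (dirac p.2)) (discrete s)).
rewrite IH => [|q qs]; last by rewrite s0// inE qs orbT.
rewrite big_cons EFinD EFinM; congr (_ * _ + _)%E.
by rewrite /= ger0_norm// s0// mem_head.
Qed.

Lemma ge0_integral_discrete s (f : T -> \bar R) :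
  (forall p, p \in s -> 0 <= p.1) -> measurable_fun setT f ->
  (forall x, (0 <= f x)%E) ->
  (\int[discrete s]_x f x = \sum_(p <- s) p.1%:E * f p.2)%E.
Proof.
move=> + mf f0; elim: s => [|p s IH] s0.
  by rewrite big_nil integral_measure_zero.
rewrite /= ge0_integral_measure_add// big_cons IH => [|q qs]; last first.
  by rewrite s0// inE qs orbT.
rewrite ge0_integral_mscale// integral_dirac// diracT mul1e/=.
by rewrite ger0_norm ?s0 ?mem_head.
Qed.

Lemma discrete_integral s (f : T -> R) :
  (forall p, p \in s -> 0 <= p.1) -> measurable_fun setT f ->
  (\int[discrete s]_x (f x)%:E = (\sum_(p <- s) p.1 * f p.2)%:E)%E.
Proof.
move=> s0 mf; have mEf : measurable_fun setT (EFin \o f) by exact/measurable_EFinP.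
rewrite integralE.
rewrite !ge0_integral_discrete//.
- rewrite -sumEFin.
  under eq_bigr do rewrite /= funeposE/= -EFin_max -EFinM.
  under [X in (_ - X)%E]eq_bigr do rewrite /= funenegE/= -EFin_max -EFinM.
  rewrite !sumEFin -EFinB -sumrB; congr EFin; apply: eq_bigr => p _.
  by rewrite -mulrBr; congr (_ * _); rewrite /Num.max; do 2 case: ifPn; lra.
- exact: measurable_funeneg.
- exact: measurable_funepos.
Qed.

Lemma discrete_integrable s (f : T -> R) :
  (forall p, p \in s -> 0 <= p.1) -> measurable_fun setT f ->
  (discrete s).-integrable setT (EFin \o f).
Proof.
move=> s0 mf; apply/integrableP; split; first exact/measurable_EFinP.
under eq_integral do rewrite /=.
rewrite discrete_integral//; first exact: ltry.
exact: measurableT_comp.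
Qed.

(* Integrals of nonnegative functions are suprema over simple minorants, so
   that the comparisons below need no measurability of the larger function. *)
Lemma ge0_le_integral_nomeas (mu : {measure set T -> \bar R}) (f g : T -> \bar R) :
  (forall x, (0 <= f x)%E) -> (forall x, (f x <= g x)%E) ->
  (\int[mu]_x f x <= \int[mu]_x g x)%E.
Proof.
move=> f0 fg; have g0 x : (0 <= g x)%E by exact: le_trans (f0 x) (fg x).
rewrite !ge0_integralTE//; apply: ereal_sup_le => _ [h /= hf <-].
by exists h => // x; exact: le_trans (hf x) (fg x).
Qed.

(** One inequality, but for [f] not known to be measurable: it is applied to the transport cost on
    the product sigma-algebra. *)
Lemma discrete_integral_le s (f : T -> R) :
  (forall p, p \in s -> 0 <= p.1) -> (forall x, 0 <= f x) ->
  (\int[discrete s]_x (f x)%:E <= (\sum_(p <- s) p.1 * f p.2)%:E)%E.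
Proof.
move=> s0 f0; rewrite ge0_integralTE; last by move=> x; rewrite lee_fin.
apply: ge_ereal_sup => _ [h /= hf <-].
rewrite -integralT_nnsfun discrete_integral//.
rewrite lee_fin big_seq [leRHS]big_seq.
apply: ler_sum => p ps; rewrite ler_wpM2l ?s0//.
by have := hf p.2; rewrite lee_fin.
Qed.

Section Probability.
Variables (s : seq (R * T)) (sT : discrete s setT = 1%E).

Definition discrete_prob of discrete s setT = 1%E : set T -> \bar R :=
  discrete s.

HB.instance Definition _ := isMeasure.Build _ _ _ (discrete_prob sT)
  (measure0 (discrete s)) (measure_ge0 (discrete s))
  (@measure_semi_sigma_additive _ _ _ (discrete s)).

HB.instance Definition _ :=
  Measure_isProbability.Build _ _ _ (discrete_prob sT) sT.

End Probability.

Lemma discrete_probability s : (forall p, p \in s -> 0 <= p.1) ->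
  \sum_(p <- s) p.1 = 1 ->
  exists P : probability T R, forall A, P A = discrete s A.
Proof.
move=> s0 s1.
have sT : discrete s setT = 1%E.
  rewrite discreteE//; congr EFin; rewrite -s1; apply: eq_bigr => p _.
  by rewrite indicT mulr1.
by exists (discrete_prob sT).
Qed.

End Discrete.

(** * Weak duality *)

Section SecondMoment.
Variables (R : realType) (n : nat).
Local Notation T := (borel_vec R n).
Implicit Types (m : 'cV[R]_n) (G : 'M[R]_n).

Lemma measurable_dev_prod m i j : measurable_fun setT (@dev_prod R n m i j).
Proof.
have mc k : measurable_fun setT (fun u : T => ((u : 'cV[R]_n) - m) k ord0).
  rewrite (_ : (fun u : T => _) = fun u : T => (u : 'cV[R]_n) k ord0 - m k ord0).
    by apply: measurable_funB => //; exact: measurable_coord.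
  by apply/funext => u; rewrite !mxE.
exact: measurable_funM.
Qed.

Lemma quad_dev_prod m G (u : T) :
  dot ((u : 'cV[R]_n) - m) (G *m ((u : 'cV[R]_n) - m)) =
  \sum_i \sum_j G i j * dev_prod m i j u.
Proof. by rewrite dot_mulmxE. Qed.

Lemma measurable_quad m G :
  measurable_fun setT
    (fun u : T => dot ((u : 'cV[R]_n) - m) (G *m ((u : 'cV[R]_n) - m))).
Proof.
under eq_fun do rewrite quad_dev_prod.
apply: measurable_sum => i; apply: measurable_sum => j.
by apply: measurable_funM => //; exact: measurable_dev_prod.
Qed.

Lemma integral_quad (mu : probability T R) m G :
  (forall i j, mu.-integrable setT (EFin \o dev_prod m i j)) ->
  (\int[mu]_u (dot ((u : 'cV[R]_n) - m) (G *m ((u : 'cV[R]_n) - m)))%:E =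
   (\tr (G *m second_moment mu m))%:E)%E.
Proof.
move=> int_dev; under eq_integral do rewrite quad_dev_prod -sumEFin.
have int_i i : mu.-integrable setT
    (fun u => (\sum_j G i j * dev_prod m i j u)%:E).
  under eq_fun do rewrite -sumEFin.
  apply: integrable_sum => // j _; under eq_fun do rewrite EFinM.
  by apply: integrableZl => //; exact: int_dev.
rewrite integral_sum// mxtrace_mulmxE -sumEFin; apply: eq_bigr => i _.
under eq_integral do rewrite -sumEFin.
rewrite integral_sum//; last first.
  by move=> j; under eq_fun do rewrite EFinM; apply: integrableZl => //; exact: int_dev.
rewrite -sumEFin; apply: eq_bigr => j _.
under eq_integral do rewrite EFinM.
rewrite (integralZl measurableT (int_dev i j)) EFinM mxE; congr (_ * _)%E.
rewrite (_ : dev_prod m j i = dev_prod m i j); last first.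
  by apply/funext => u; rewrite /dev_prod mulrC.
rewrite unlock fineK//.
exact: (integrable_fin_num measurableT (int_dev i j)).
Qed.

End SecondMoment.

Section WeakDuality.
Variables (R : realType) (n : nat) (K : finType).
Local Notation T := (borel_vec R n).
Variables (a : K -> 'cV[R]_n) (b : K -> R) (Psi : 'cV[R]_n -> R).
Hypothesis Psi_ge0 : forall u, 0 <= Psi u.
Hypothesis Psi_ge : forall k u, dot (a k) u + b k <= Psi u.
Hypothesis Psi_attained : forall u, exists k, Psi u = dot (a k) u + b k.

(** [Psi] is a finite maximum of affine functions; the default [0] of the maximum is harmless
    because [Psi] is nonnegative. *)
Lemma measurable_max_affine : measurable_fun setT (Psi : T -> R).
Proof.
rewrite (_ : Psi = fun u => \big[Num.max/0]_k (dot (a k) u + b k)).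
  by apply: measurable_bigmax => k; apply: measurable_funD => //; exact: measurable_dot.
apply/funext => u; apply/eqP; rewrite eq_le; apply/andP; split.
  have [k ->] := Psi_attained u.
  exact: (le_bigmax _ (fun k => dot (a k) u + b k)).
by apply: bigmax_le.
Qed.

Variables (nm : 'cV[R]_n -> R) (nmP : is_norm nm).
Variables (N : nat) (N_gt0 : (0 < N)%N) (xihat : 'I_N -> 'cV[R]_n).

Lemma integral_empirical (f : T -> \bar R) : measurable_fun setT f ->
  (forall u, (0 <= f u)%E) ->
  (\int[empirical xihat]_u f u = \sum_(i < N) N%:R^-1%:E * f (xihat i))%E.
Proof.
move=> mf f0.
pose s : seq (R * T) := [seq (N%:R^-1, xihat i : T) | i <- index_enum 'I_N].
have s0 p : p \in s -> 0 <= p.1.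
  by case/mapP => i _ ->; rewrite /= invr_ge0.
rewrite (eq_measure_integral (discrete s)) => [|A mA _].
  by rewrite ge0_integral_discrete// big_map.
rewrite [LHS]empiricalE discreteE// big_map -mulr_sumr EFinM; congr (_ * _)%E.
by rewrite -sumEFin; apply: eq_bigr => i _; rewrite /= diracE indicE.
Qed.

Lemma weak_duality (theta tau : R) (y : 'I_N -> R) (zeta : 'I_N -> K -> 'cV[R]_n)
    (lam : R) (G : 'M[R]_n) (mu : probability T R) :
  let m := sample_mean xihat in
  0 <= lam -> psd G ->
  (forall i k u, dot (a k) u + b k <=
     y i + dot (u - m) (G *m (u - m)) + dot (zeta i k) (u - xihat i)) ->
  (forall i k w, dot (zeta i k) w <= lam * nm w) ->
  ambiguity_set nm xihat theta tau mu ->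
  (\int[mu]_u (Psi u)%:E <= (lam * theta + tau * \tr (G *m sample_cov xihat)
     + N%:R^-1 * \sum_i y i)%:E)%E.
Proof.
move=> m lam0 Gp dual_y zeta_le [muW [int_dev mu_le]].
apply/lee_addgt0Pr => e e0.
(* A coupling optimal up to a slack which, once multiplied by [lam], stays below [e]. *)
have [gam gamC gam_lt] : exists2 gam : probability (T * T)%type R,
    is_coupling mu (empirical xihat) gam &
    (\int[gam]_z (nm ((z.1 : 'cV[R]_n) - z.2))%:E < (theta + e / (lam + 1))%:E)%E.
  have : (wasserstein nm mu (empirical xihat) < (theta + e / (lam + 1))%:E)%E.
    apply: le_lt_trans muW _; rewrite lte_fin ltrDl divr_gt0//.
    by rewrite ltr_wpDl.
  by move=> /ereal_inf_lt[_ [gam gamC <-]] ?; exists gam.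
(* This shift makes the integrands nonnegative, so that integrals add up without integrability
   conditions. *)
pose c0 := \sum_i `|y i|.
have y_ge i : 0 <= y i + c0.
  have : `|y i| <= c0 by rewrite /c0 (bigD1 i)//= lerDl sumr_ge0.
  by have := ler_norm (- y i); rewrite normrN; lra.
(* The variables [y i] as a function on the whole space: at a sample value, the smallest shifted
   [y i] among the samples located there; elsewhere [+oo], where the empirical measure has no
   mass. *)
pose Y (u : T) : \bar R :=
  \big[mine/+oo%E]_i (if `[< u = xihat i >] then (y i + c0)%:E else +oo%E).
have mY : measurable_fun setT Y.
  rewrite /Y; elim: (index_enum _) => [|i r IH].
    by under eq_fun do rewrite big_nil; exact: measurable_cst.
  under eq_fun do rewrite big_cons; apply: measurable_mine => //.
  apply: measurable_fun_ifT => //; apply: (measurable_fun_bool true).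
  rewrite setTI (_ : _ @^-1` _ = [set xihat i]).
    exact: measurable_singleton.
  by apply/seteqP; split => u /=; [move/asboolP|move=> ->; exact/asboolP].
have Y0 u : (0 <= Y u)%E.
  rewrite /Y; elim/big_ind: _ => [|v w v0 w0|i _].
  - exact: leey.
  - by rewrite le_min v0 w0.
  - by case: ifP => _; [rewrite lee_fin|exact: leey].
have intY : (\int[empirical xihat]_u Y u <= (N%:R^-1 * \sum_i y i + c0)%:E)%E.
  rewrite integral_empirical//.
  have -> : N%:R^-1 * \sum_i y i + c0 = \sum_(i < N) N%:R^-1 * (y i + c0).
    rewrite -mulr_sumr big_split/= mulrDr sumr_const card_ord.
    by rewrite -[c0 *+ N]mulr_natl mulrA mulVf ?mul1r// pnatr_eq0 -lt0n.
  rewrite -sumEFin; apply: lee_sum => i _; rewrite EFinM lee_wpmul2l//.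
  rewrite /Y (bigD1 i)//= ge_min; apply/orP; left.
  by case: asboolP.
pose q (u : 'cV[R]_n) := dot (u - m) (G *m (u - m)).
have q0 u : 0 <= q u by exact: psd_ge0.
(* A measurable stand-in for the transport cost: a finite maximum lying below the norm. If
   [lam = 0], its inverse is [0] and [H] vanishes. *)
pose H (z : (T * T)%type) := \big[Num.max/0]_(p : 'I_N * K)
  (lam^-1 * `|dot (zeta p.1 p.2) z.1 - dot (zeta p.1 p.2) z.2|).
have mH : measurable_fun setT H.
  apply: measurable_bigmax => p; apply: measurable_funM => //.
  apply: measurableT_comp => //; apply: measurable_funB.
    apply: (@measurableT_comp _ _ _ _ _ _ (fun u : T => dot (zeta p.1 p.2) u)) => //.
    exact: measurable_dot.
  apply: (@measurableT_comp _ _ _ _ _ _ (fun u : T => dot (zeta p.1 p.2) u)) => //.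
  exact: measurable_dot.
have zeta_norm i k (u v : 'cV[R]_n) :
    `|dot (zeta i k) u - dot (zeta i k) v| <= lam * nm (u - v).
  rewrite -dotNr -dotDr ler_norml zeta_le andbT lerNl -dotNr.
  by rewrite (le_trans (zeta_le _ _ _))// (is_normN nmP).
have H0 z : 0 <= H z.
  by rewrite /H; exact: bigmax_ge_id.
have H_le z : H z <= nm ((z.1 : 'cV[R]_n) - z.2).
  apply: bigmax_le => [|p _]; first exact: is_norm_ge0.
  have [->|l0] := eqVneq lam 0; first by rewrite invr0 mul0r; exact: is_norm_ge0.
  rewrite mulrC ler_pdivrMr; first by rewrite mulrC; exact: zeta_norm.
  by rewrite lt_neqAle eq_sym l0.
(* The dual inequality at every pair of points, in the form that is integrated against the
   coupling. *)
have pt z : ((Psi z.1 + c0)%:E <= Y z.2 + (q z.1)%:E + (lam * H z)%:E)%E.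
  have key i : z.2 = xihat i -> Psi z.1 + c0 <= y i + c0 + q z.1 + lam * H z.
    move=> z2; have [k ->] := Psi_attained z.1.
    have := dual_y i k z.1; rewrite -/(q _) -z2 dotDr dotNr.
    suff : dot (zeta i k) z.1 - dot (zeta i k) z.2 <= lam * H z by lra.
    have [l0|l0] := eqVneq lam 0.
      have := zeta_norm i k z.1 z.2; rewrite l0 !mul0r.
      by apply: le_trans; exact: ler_norm.
    have lgt0 : 0 < lam by rewrite lt_neqAle eq_sym l0.
    rewrite -ler_pdivrMl//.
    apply: le_trans (le_bigmax _ _ (i, k)) => /=.
    by rewrite ler_wpM2l ?invr_ge0// ler_norm.
  rewrite /Y; elim/big_ind: _ => [|v w v0 w0|i _].
  - by rewrite !addye// leey.
  - by rewrite /mine; case: ifP.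
  - case: asboolP => [z2|_]; last by rewrite !addye// leey.
    by rewrite -!EFinD lee_fin key.
have mPsi := measurable_max_affine.
have mfst : measurable_fun setT (fst : (T * T)%type -> T) by exact: measurable_fst.
have msnd : measurable_fun setT (snd : (T * T)%type -> T) by exact: measurable_snd.
have marg1 (f : T -> \bar R) : measurable_fun setT f -> (forall u, (0 <= f u)%E) ->
    (\int[gam]_z f z.1 = \int[mu]_u f u)%E.
  move=> mf f0.
  rewrite -[LHS](ge0_integral_pushforward mfst gam (D := setT) (f := f))//.
  by apply: eq_measure_integral => A mA _; have [h _] := gamC A mA; exact: h.
have marg2 (f : T -> \bar R) : measurable_fun setT f -> (forall u, (0 <= f u)%E) ->
    (\int[gam]_z f z.2 = \int[empirical xihat]_u f u)%E.
  move=> mf f0.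
  rewrite -[LHS](ge0_integral_pushforward msnd gam (D := setT) (f := f))//.
  by apply: eq_measure_integral => A mA _; have [_ h] := gamC A mA; exact: h.
have mq : measurable_fun setT (fun u : T => (q u)%:E).
  by apply/measurable_EFinP; exact: measurable_quad.
have : (\int[gam]_z ((Psi z.1)%:E + c0%:E) <=
        \int[gam]_z (Y z.2 + (q z.1)%:E + (lam * H z)%:E))%E.
  apply: ge0_le_integral_nomeas => z; last by rewrite -EFinD.
  by rewrite -EFinD lee_fin addr_ge0// /c0 sumr_ge0.
have mPsi1 : measurable_fun setT (fun z : (T * T)%type => (Psi z.1)%:E).
  by apply/measurable_EFinP; exact: (measurableT_comp mPsi).
have mY2 : measurable_fun setT (fun z : (T * T)%type => Y z.2).
  exact: (measurableT_comp mY).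
have mq1 : measurable_fun setT (fun z : (T * T)%type => (q z.1)%:E).
  exact: (measurableT_comp mq).
have mlH : measurable_fun setT (fun z : (T * T)%type => (lam * H z)%:E).
  by apply/measurable_EFinP; exact: measurable_funM.
have c00 : 0 <= c0 by rewrite /c0 sumr_ge0.
rewrite ge0_integralD//; last first.
  by move=> z _; rewrite lee_fin.
rewrite (marg1 (EFin \o Psi)) /=; last 2 first.
- exact/measurable_EFinP.
- by move=> u; rewrite lee_fin.
rewrite integral_cst//= probability_setT mule1.
rewrite ge0_integralD//; last 3 first.
- by move=> z _; rewrite adde_ge0// lee_fin.
- exact: emeasurable_funD.
- by move=> z _; rewrite lee_fin mulr_ge0.
rewrite ge0_integralD//; last by move=> z _; rewrite lee_fin.
rewrite (marg2 Y)// (marg1 (EFin \o q))//= integral_quad//.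
under [X in (_ <= _ + X)%E -> _]eq_integral do rewrite EFinM.
rewrite ge0_integralZl_EFin//; last 2 first.
- by move=> z _; rewrite lee_fin.
- exact/measurable_EFinP.
have HW : (\int[gam]_z (H z)%:E <= (theta + e / (lam + 1))%:E)%E.
  apply: le_trans (ltW gam_lt); apply: ge0_le_integral_nomeas => z.
    by rewrite lee_fin.
  by rewrite lee_fin.
have trG : \tr (G *m second_moment mu m) <= tau * \tr (G *m sample_cov xihat).
  have := psd_trace_ge0 Gp mu_le.
  by rewrite mulmxBr linearB/= -scalemxAr linearZ/= subr_ge0.
move=> le1.
have : (\int[mu]_u (Psi u)%:E + c0%:E <= (N%:R^-1 * \sum_i y i + c0
   + tau * \tr (G *m sample_cov xihat) + lam * (theta + e / (lam + 1)))%:E)%E.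
  apply: (le_trans le1); rewrite !EFinD; apply: leeD.
    by apply: leeD => //; rewrite lee_fin.
  by rewrite EFinM; apply: lee_wpmul2l; rewrite ?lee_fin.
rewrite -leeBrDr// => /le_trans; apply; rewrite -EFinB -EFinD lee_fin.
have : lam * (e / (lam + 1)) <= e.
  rewrite mulrA ler_pdivrMr ?ltr_wpDl// [leRHS]mulrC.
  by rewrite ler_wpM2r ?(ltW e0)// lerDl.
lra.
Qed.

End WeakDuality.

(** * Lagrange multipliers for finite plans *)

Section Plan.
Variables (R : realType) (N : nat).
Implicit Type U : Type.

(* A plan is a finite mixture of assignments [u], each of which moves the mass
   [1/N] of the sample [i] to the point [u i]. *)
Definition is_plan U (p : seq (R * ('I_N -> U))) : Prop :=
  all (fun q => 0 <= q.1) p /\ \sum_(q <- p) q.1 = 1.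

(** Transport cost, moments and value are all averages of this shape; being linear in the weights,
    they make the attainable set convex for arbitrary [f]. *)
Definition plan_avg U (f : 'I_N -> U -> R) (p : seq (R * ('I_N -> U))) : R :=
  \sum_(q <- p) q.1 * (N%:R^-1 * \sum_i f i (q.2 i)).

Definition plan_mix U (s t : R) (p q : seq (R * ('I_N -> U))) :=
  [seq (s * x.1, x.2) | x <- p] ++ [seq (t * x.1, x.2) | x <- q].

Lemma plan_avg_mix U (f : 'I_N -> U -> R) s t p q :
  plan_avg f (plan_mix s t p q) = s * plan_avg f p + t * plan_avg f q.
Proof.
rewrite /plan_avg big_cat !big_map/= !mulr_sumr.
by congr (_ + _); apply: eq_bigr => x _; rewrite mulrA.
Qed.

Lemma is_plan_mix U s t (p q : seq (R * ('I_N -> U))) : 0 <= s -> 0 <= t ->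
  s + t = 1 -> is_plan p -> is_plan q -> is_plan (plan_mix s t p q).
Proof.
move=> s0 t0 st1 [p0 p1] [q0 q1]; split.
  rewrite all_cat !all_map; apply/andP; split.
    by apply: sub_all p0 => x /=; exact: mulr_ge0.
  by apply: sub_all q0 => x /=; exact: mulr_ge0.
by rewrite big_cat !big_map/= -!mulr_sumr p1 q1 !mulr1.
Qed.

Lemma is_plan1 U (u : 'I_N -> U) : is_plan [:: (1, u)].
Proof. by split; [rewrite /= ler01|rewrite big_seq1]. Qed.

Lemma plan_avg1 U (f : 'I_N -> U -> R) (u : 'I_N -> U) :
  plan_avg f [:: (1, u)] = N%:R^-1 * \sum_i f i (u i).
Proof. by rewrite /plan_avg big_seq1 mul1r. Qed.

Lemma plan_avg_map U V (g : U -> V) (f : 'I_N -> V -> R) p :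
  plan_avg f [seq (q.1, g \o q.2) | q <- p] = plan_avg (fun i => f i \o g) p.
Proof. by rewrite /plan_avg big_map. Qed.

Lemma is_plan_map U V (g : U -> V) (p : seq (R * ('I_N -> U))) :
  is_plan p -> is_plan [seq (q.1, g \o q.2) | q <- p].
Proof. by case=> p0 p1; split; [rewrite all_map|rewrite big_map]. Qed.

End Plan.

Lemma ray_bounded (R : realType) (x y z : R) :
  (forall s, 0 <= s -> x + s * y <= z) -> y <= 0.
Proof.
move=> H; rewrite leNgt; apply/negP => y0.
have := H ((`|z - x| + 1) / y); rewrite divr_ge0 ?addr_ge0 ?(ltW y0)//.
move=> /(_ isT); rewrite divfK ?lt0r_neq0//.
by have := ler_norm (z - x); lra.
Qed.

Section Multipliers.
Variables (R : realType) (N r : nat).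
Variables (f c : 'I_N -> 'cV[R]_r -> R) (theta tau v : R) (S : 'M[R]_r).

Local Notation mom w := (plan_avg (fun _ u => dot u w ^+ 2)).

(** The strict cost bound and the tolerance of small moment perturbations in every direction [Z]
    form a Slater condition: they put the origin in the algebraic interior required by
    [convex_support]. The conclusion comes from testing the supporting hyperplane on plans made of a
    single assignment. *)
Lemma lagrange_multipliers (u0 : 'I_N -> 'cV[R]_r) :
  S^T = S ->
  plan_avg c [:: (1, u0)] < theta ->
  (forall Z : 'M[R]_r, exists2 t0, 0 < t0 & forall t, 0 < t -> t <= t0 ->
     forall w, mom w [:: (1, u0)] <= tau * dot w (S *m w) + t * dot w (Z *m w)) ->
  (forall p, is_plan p -> plan_avg c p <= theta ->
     (forall w, mom w p <= tau * dot w (S *m w)) -> plan_avg f p <= v) ->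
  exists lam G, [/\ 0 <= lam, psd G & forall u : 'I_N -> 'cV[R]_r,
    N%:R^-1 * \sum_i (f i (u i) - lam * c i (u i) - dot (u i) (G *m u i))
    <= v - lam * theta - tau * \tr (G *m S)].
Proof.
move=> Ssym slater_c slater_m val.
(* [z] relaxes the right-hand sides of the cost and moment constraints, and [- j] is a value that
   some plan reaches or exceeds. *)
pose A (z : R^o * 'M[R]_r) (j : R) := exists p, [/\ is_plan p,
  plan_avg c p <= theta + z.1,
  forall w, mom w p <= tau * dot w (S *m w) + dot w (z.2 *m w) &
  - j <= plan_avg f p].
have [|||l [lD lZ lA]] := @convex_support R (R^o * 'M[R]_r)%type A (- v).
- move=> z i z' j s t [p [pP pc pm pf]] [q [qP qc qm qf]] s0 t0 st1.
  exists (plan_mix s t p q); split.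
  + by apply: is_plan_mix => //; exact: ltW.
  + rewrite plan_avg_mix/=.
    have -> : theta + (s *: z.1 + t *: z'.1) = s * (theta + z.1) + t * (theta + z'.1).
      by rewrite /GRing.scale/= -[theta in LHS]mul1r -st1; ring.
    by apply: lerD; rewrite ler_pM2l.
  + move=> w; rewrite plan_avg_mix/= mulmxDl -!scalemxAl dotDr !dotZr.
    move: (pm w) (qm w); rewrite -(ler_pM2l s0) => H3; rewrite -(ler_pM2l t0) => H4.
    have -> : tau * dot w (S *m w) =
        s * (tau * dot w (S *m w)) + t * (tau * dot w (S *m w)).
      by rewrite -mulrDl st1 mul1r.
    lra.
  + rewrite plan_avg_mix; move: pf qf; rewrite -(ler_pM2l s0) => H1.
    by rewrite -(ler_pM2l t0); lra.
- move=> [x Z]; have [t0 t00 H] := slater_m Z.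
  pose dl := theta - plan_avg c [:: (1, u0)].
  have dl0 : 0 < dl by rewrite subr_gt0.
  pose t := Num.min t0 (dl / (`|x| + 1)).
  have x1 : 0 < `|x| + 1 by rewrite ltr_wpDl.
  have tp : 0 < t by rewrite lt_min t00 divr_gt0.
  exists t, (- plan_avg f [:: (1, u0)]); split=> //.
  exists [:: (1, u0)]; split; [exact: is_plan1| | |by rewrite opprK].
    have : t * (`|x| + 1) <= dl by rewrite -ler_pdivlMr// ge_min lexx orbT.
    have : t * - x <= t * `|x| by rewrite ler_pM2l// -normrN ler_norm.
    by rewrite /dl /= /GRing.scale/=; lra.
  move=> w; rewrite /= -scalemxAl dotZr; apply: H => //.
  by rewrite ge_min lexx.
- move=> j [p [pP pc pm pf]]; rewrite lerNl (le_trans pf)// val//.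
    by move: pc; rewrite addr0.
  by move=> w; have := pm w; rewrite mul0mx dot0r addr0.
pose lam := - l (1, 0).
pose G0 := \matrix_(i, j) - l (0, delta_mx i j).
have l00 : l (0, 0) = 0.
  have -> : ((0, 0) : R^o * 'M[R]_r) = 0 *: (0, 0).
    by rewrite scale0r.
  by rewrite lZ mul0r.
have lE x (Z : 'M[R]_r) : l (x, Z) = - (lam * x) - \sum_i \sum_j G0 i j * Z i j.
  have -> : (x, Z) = x *: (1, 0) + (0, Z).
    by congr pair; rewrite /= ?scaler0 ?add0r// addr0 /GRing.scale/= mulr1.
  rewrite lD lZ /lam mulNr opprK mulrC; congr (_ + _).
  have l2D (X Y : 'M[R]_r) : l (0, X + Y) = l (0, X) + l (0, Y).
    by rewrite -lD; congr l; congr pair; rewrite /= addr0.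
  rewrite [Z in LHS]matrix_sum_delta (big_morph (fun X => l (0, X)) l2D l00).
  rewrite -sumrN; apply: eq_bigr => i _.
  rewrite (big_morph (fun X => l (0, X)) l2D l00) -sumrN; apply: eq_bigr => j _.
  rewrite mxE mulNr opprK mulrC -lZ; congr l; congr pair.
  by rewrite /= scaler0.
pose M (u : 'I_N -> 'cV[R]_r) := N%:R^-1 *: \sum_i u i *m (u i)^T.
have dotM u w : dot w (M u *m w) = mom w [:: (1, u)].
  rewrite plan_avg1 -scalemxAl dotZr mulmx_suml; congr (_ * _).
  elim: (index_enum _) => [|i s IH]; first by rewrite !big_nil dot0r.
  by rewrite !big_cons dotDr IH dot_rank1.
(* The relaxation under which the single assignment [u] is feasible with equality. *)
pose z0 u : R^o * 'M[R]_r := (plan_avg c [:: (1, u)] - theta, M u - tau *: S).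
have Az u x Y : 0 <= x -> (forall w, 0 <= dot w (Y *m w)) ->
    - v + l (z0 u + (x, Y)) <= - plan_avg f [:: (1, u)].
  move=> x0 Y0; apply: lA; exists [:: (1, u)]; split.
  - exact: is_plan1.
  - by rewrite /=; lra.
  - move=> w /=; rewrite !mulmxDl mulNmx -(scalemxAl tau S w) !dotDr dotNr dotZr dotM.
    by have := Y0 w; lra.
  - by rewrite opprK.
(* Relaxing further keeps [u] feasible, so [l] is bounded above along rays of nonnegative
   relaxations and its slope there is nonpositive. The same argument gives [G0_ge0]. *)
have lam0 : 0 <= lam.
  rewrite oppr_ge0; apply: (@ray_bounded R (- v + l (z0 u0)) _
    (- plan_avg f [:: (1, u0)])) => s s0.
  rewrite -addrA -lZ -lD.
  have -> : s *: ((1, 0) : R^o * 'M[R]_r) = (s, 0).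
    by congr pair; rewrite /= ?scaler0// /GRing.scale/= mulr1.
  by apply: Az => // w; rewrite mul0mx dot0r.
have G0_ge0 w : 0 <= dot w (G0 *m w).
  have lw : l (0, w *m w^T) = - dot w (G0 *m w).
    rewrite lE mulr0 oppr0 add0r dot_mulmxE; congr (- _).
    apply: eq_bigr => i _; apply: eq_bigr => j _; congr (_ * _).
    by rewrite mxE big_ord1 mxE.
  rewrite -oppr_le0 -lw; apply: (@ray_bounded R (- v + l (z0 u0)) _
    (- plan_avg f [:: (1, u0)])) => s s0.
  rewrite -addrA -lZ -lD.
  have -> : s *: ((0, w *m w^T) : R^o * 'M[R]_r) = (0, s *: (w *m w^T)).
    by congr pair; rewrite /= scaler0.
  apply: Az => // w'; rewrite -scalemxAl dotZr dot_rank1.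
  by rewrite mulr_ge0// sqr_ge0.
(* [Z] ranges over all matrices, so [G0] may fail to be symmetric; symmetrising changes neither
   quadratic values nor traces against symmetric matrices. *)
pose G := 2^-1 *: (G0 + G0^T).
have G0T w : dot w (G0^T *m w) = dot w (G0 *m w).
  by rewrite -dot_mulmxl dotC.
have GE w : dot w (G *m w) = dot w (G0 *m w).
  by rewrite /G -scalemxAl dotZr mulmxDl dotDr G0T; field.
have trG (Y : 'M[R]_r) : Y^T = Y ->
    \tr (G *m Y) = \sum_i \sum_j G0 i j * Y i j.
  move=> Ysym; transitivity (\tr (G0 *m Y)).
    rewrite /G -scalemxAl linearZ/= mulmxDl linearD/=.
    rewrite -[X in _ + X]mxtrace_tr trmx_mul trmxK Ysym mxtrace_mulC.
    by rewrite -{2}Ysym mxtrace_mulC mxtrace_mulC Ysym; field.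
  rewrite mxtrace_mulmxE; apply: eq_bigr => i _; apply: eq_bigr => j _.
  by congr (_ * _); rewrite -[in LHS]Ysym mxE.
exists lam, G; split=> //.
  split=> [|w]; last by rewrite GE.
  by rewrite /G linearZ/= linearD/= trmxK addrC.
move=> u; have : - v + l (z0 u) <= - plan_avg f [:: (1, u)].
  have -> : z0 u = z0 u + (0, 0) by congr pair; rewrite /= addr0.
  by apply: Az => // w; rewrite mul0mx dot0r.
rewrite lE.
have MT : (M u)^T = M u.
  rewrite /M linearZ/= raddf_sum/=; congr (_ *: _); apply: eq_bigr => i _.
  by rewrite trmx_mul trmxK.
rewrite -trG; last by rewrite linearB/= MT linearZ/= Ssym.
rewrite mulmxBr linearB/= -(scalemxAr tau) [\tr (tau *: _)]linearZ/=.
have -> : \tr (G *m M u) = N%:R^-1 * \sum_i dot (u i) (G *m u i).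
  rewrite /M -scalemxAr linearZ/= mulmx_sumr raddf_sum/=; congr (_ * _).
  by apply: eq_bigr => i _; rewrite quad_trace.
rewrite !plan_avg1 !sumrB -mulr_sumr !mulrBr; lra.
Qed.

End Multipliers.

(** * Plans realised as probability measures *)

Section PlanSeq.
Variables (R : realType) (N : nat) (N_gt0 : (0 < N)%N).

(** With [g i u = u] this lists the atoms of the distribution of a plan, with [g i u = (u, xihat i)]
    those of its coupling with the samples. *)
Definition plan_seq U V (g : 'I_N -> U -> V) (p : seq (R * ('I_N -> U))) :
    seq (R * V) :=
  [seq (x.1 * N%:R^-1, g i (x.2 i)) | x <- p, i <- index_enum 'I_N].

Lemma plan_seq_sum U V (g : 'I_N -> U -> V) (F : V -> R) p :
  \sum_(q <- plan_seq g p) q.1 * F q.2 = plan_avg (fun i u => F (g i u)) p.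
Proof.
rewrite /plan_seq /plan_avg big_allpairs_dep/=; apply: eq_bigr => x _.
by rewrite mulrA mulr_sumr.
Qed.

Lemma plan_seq_ge0 U (V : eqType) (g : 'I_N -> U -> V) p :
  is_plan p -> forall q, q \in plan_seq g p -> 0 <= q.1.
Proof.
case=> p0 _; apply/allP; elim: p p0 => //= x p IH /andP[x0 p0].
rewrite all_cat IH// andbT all_map; apply/allP => i _ /=.
by rewrite mulr_ge0// invr_ge0.
Qed.

Lemma plan_seq_total U V (g : 'I_N -> U -> V) p :
  is_plan p -> \sum_(q <- plan_seq g p) q.1 = 1.
Proof.
case=> _ p1; have := plan_seq_sum g (fun=> 1) p.
under eq_bigr do rewrite mulr1; move=> ->; rewrite -[RHS]p1 /plan_avg.
apply: eq_bigr => x _.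
by rewrite sumr_const card_ord mulVf ?mulr1// pnatr_eq0 -lt0n.
Qed.

End PlanSeq.

Section PlanMeasure.
Variables (R : realType) (n N : nat) (N_gt0 : (0 < N)%N).
Local Notation T := (borel_vec R n).
Variables (nm : 'cV[R]_n -> R) (nmP : is_norm nm) (xihat : 'I_N -> 'cV[R]_n).

(** Pairing each atom with the sample it came from gives a coupling with the empirical measure,
    because the weights of the plan sum to one; its cost bounds the Wasserstein distance. *)
Lemma plan_ambiguity (theta tau : R) (p : seq (R * ('I_N -> 'cV[R]_n))) :
  is_plan p ->
  plan_avg (fun i u => nm (u - xihat i)) p <= theta ->
  (forall w, plan_avg (fun _ u => dot (u - sample_mean xihat) w ^+ 2) p
             <= tau * dot w (sample_cov xihat *m w)) ->
  exists2 mu : probability T R, ambiguity_set nm xihat theta tau mu &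
    forall f : T -> R, measurable_fun setT f ->
      (\int[mu]_u (f u)%:E = (plan_avg (fun _ u => f u) p)%:E)%E.
Proof.
move=> pP cost_le mom_le.
pose s : seq (R * T) := plan_seq (fun _ u => u) p.
pose s2 : seq (R * (T * T)) := plan_seq (fun i u => (u, xihat i)) p.
have s0 : forall q, q \in s -> 0 <= q.1 by exact: plan_seq_ge0.
have s20 : forall q, q \in s2 -> 0 <= q.1 by exact: plan_seq_ge0.
have [mu muE] := discrete_probability s0 (plan_seq_total N_gt0 _ pP).
have [gam gamE] := discrete_probability s20 (plan_seq_total N_gt0 _ pP).
have int_mu (f : T -> R) : measurable_fun setT f ->
    (\int[mu]_u (f u)%:E = (plan_avg (fun _ u => f u) p)%:E)%E.
  move=> mf; rewrite (eq_measure_integral (discrete s)) => [|A _ _].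
    by rewrite discrete_integral// plan_seq_sum.
  exact: muE.
have int_dev i j : mu.-integrable setT (EFin \o dev_prod (sample_mean xihat) i j).
  have := discrete_integrable s0 (measurable_dev_prod (sample_mean xihat) i j).
  move=> /integrableP[mdev dev_lt]; apply/integrableP; split=> //.
  rewrite (eq_measure_integral (discrete s)) => [//|A _ _]; exact: muE.
exists mu => //; split.
  apply: (@le_trans _ _ (\int[gam]_z (nm ((z.1 : 'cV[R]_n) - z.2))%:E)%E).
    apply: ereal_inf_lbound; exists gam => // A mA; split.
      transitivity (discrete s A); last exact/esym/muE.
      rewrite gamE !discreteE//; congr EFin.
      exact: etrans (plan_seq_sum _ (\1_(fst @^-1` A)) _)
        (esym (plan_seq_sum _ \1_A _)).
    rewrite empiricalE gamE discreteE//.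
    rewrite (plan_seq_sum (fun i u => (u, xihat i)) (\1_(snd @^-1` A))).
    have -> : plan_avg (fun i u => \1_(snd @^-1` A) (u : T, xihat i : T)) p =
        \sum_(x <- p) x.1 * (N%:R^-1 * \sum_i \1_A (xihat i : T)) by [].
    rewrite -mulr_suml pP.2 mul1r EFinM; congr (_ * _)%E; rewrite -sumEFin.
    by apply: eq_bigr => i _; rewrite /= diracE indicE.
  rewrite (eq_measure_integral (discrete s2)) => [|A _ _]; last exact: gamE.
  apply: le_trans (discrete_integral_le s20 _) _.
    by move=> z; exact: is_norm_ge0.
  by rewrite lee_fin (plan_seq_sum _ (fun z => nm (z.1 - z.2))).
split=> //; split.
  apply/matrixP => i j; rewrite !mxE; congr (tau * _ - fine _).
    rewrite !summxE; congr (_ * _); apply: eq_bigr => k _.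
    by rewrite !mxE !big_ord1 !mxE mulrC.
  by congr ('E_mu[_])%E; apply/funext => u; rewrite /dev_prod mulrC.
move=> w; rewrite mulmxBl -scalemxAl dotDr dotZr dotNr subr_ge0.
apply: le_trans (mom_le w); rewrite quad_trace mxtrace_mulC -lee_fin.
rewrite -integral_quad// int_mu; last exact: measurable_quad.
rewrite lee_fin; apply: ler_sum => x _ /=.
by under eq_bigr do rewrite dot_rank1 dotC.
Qed.

End PlanMeasure.

(** * Strong duality *)

(** The choices [u i] are independent, so a bound on all joint sums passes to the sum of the
    suprema. Fixing the other choices at [u0] shows that each supremum is finite; [e] pays for
    approaching each of them. *)
Lemma separable_sup (R : realType) (N : nat) (U : Type) (u0 : U)
    (F : 'I_N -> U -> R) (B e : R) :
  (forall u : 'I_N -> U, \sum_i F i (u i) <= B) -> 0 < e ->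
  exists y : 'I_N -> R, (forall i u, F i u <= y i) /\ \sum_i y i <= B + N%:R * e.
Proof.
move=> FB e0; pose y i := sup (range (F i)).
have ub i : has_ubound (range (F i)).
  exists (B - \sum_(j | j != i) F j u0) => _ [u _ <-].
  have := FB (fun j => if j == i then u else u0).
  rewrite (bigD1 i)//= eqxx lerBrDr; apply: le_trans.
  by rewrite lerD2l; apply: ler_sum => j /negbTE ->.
exists y; split=> [i u|]; first by apply: ub_le_sup => //; exists u.
have /choice[u Hu] i : exists u, y i - e < F i u.
  have [|_ [u _ <-] yu] := @sup_adherent _ (range (F i)) e e0.
    by split; [exists (F i u0), u0|exact: ub].
  by exists u.
rewrite -lerBlDr; apply: le_trans (FB u).
have -> : \sum_i y i - N%:R * e = \sum_i (y i - e).
  by rewrite sumrB sumr_const card_ord mulr_natl.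
by apply: ler_sum => i _; exact: ltW.
Qed.

Section Factor.
Variables (R : realType) (n N : nat) (xihat : 'I_N -> 'cV[R]_n).
Local Notation m := (sample_mean xihat).

(* Coordinates on the affine hull of the samples, in which the empirical
   covariance [N^-1 W W^T] is nonsingular. *)
Lemma sample_factor : exists r (C : 'M[R]_(n, r)) (W : 'M[R]_(r, N))
    (Cp : 'M[R]_(r, n)) (Wp : 'M[R]_(N, r)),
  [/\ Cp *m C = 1%:M, W *m Wp = 1%:M,
      forall i, xihat i = m + C *m col i W &
      sample_cov xihat = C *m (N%:R^-1 *: (W *m W^T)) *m C^T].
Proof.
(* The columns are the centred samples; [C] and [W] come from a full-rank factorisation, and [Cp],
   [Wp] are one-sided inverses of its factors. *)
pose B := \matrix_(j < n, i < N) (xihat i - m) j ord0.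
have /row_fullP[Cp CpE] := col_base_full B.
have /row_freeP[Wp WpE] := row_base_free B.
exists (\rank B), (col_base B), (row_base B), Cp, Wp.
have BE i : xihat i - m = col i B by apply/colP => j; rewrite !mxE.
split=> //.
  move=> i; apply/eqP; rewrite addrC -subr_eq BE -{1}[B]mulmx_base.
  by rewrite !colE mulmxA.
rewrite -scalemxAr -scalemxAl; congr (_ *: _).
rewrite mulmxA mulmx_base -mulmxA -trmx_mul mulmx_base.
under eq_bigr do rewrite BE.
apply/matrixP => j k; rewrite summxE mxE; apply: eq_bigr => i _.
by rewrite !mxE big_ord1 !mxE.
Qed.

End Factor.

Section StrongDuality.
Variables (R : realType) (n : nat) (K : finType).
Variables (a : K -> 'cV[R]_n) (b : K -> R) (Psi : 'cV[R]_n -> R).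
Hypothesis Psi_ge0 : forall u, 0 <= Psi u.
Hypothesis Psi_ge : forall k u, dot (a k) u + b k <= Psi u.
Hypothesis Psi_attained : forall u, exists k, Psi u = dot (a k) u + b k.
Variables (nm : 'cV[R]_n -> R) (nmP : is_norm nm).
Variables (N : nat) (N_gt0 : (0 < N)%N) (xihat : 'I_N -> 'cV[R]_n).
Variables (theta tau : R) (theta_gt0 : 0 < theta) (tau_ge1 : 1 <= tau).

Local Notation T := (borel_vec R n).
Local Notation m := (sample_mean xihat).

(** The gap between the two sides is [s * t] times the form at [u - v]. *)
Lemma quad_convex (G : 'M[R]_n) u v s t : psd G -> 0 <= s -> 0 <= t ->
  s + t = 1 ->
  dot (s *: u + t *: v) (G *m (s *: u + t *: v)) <=
  s * dot u (G *m u) + t * dot v (G *m v).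
Proof.
move=> Gp s0 t0 st1; have Gs := psdT Gp.
rewrite quadD// !quadZ -scalemxAr dotZl dotZr.
have := psd_ge0 (u - v) Gp; rewrite quadD// mulmxN !dotNr dotNl opprK.
move=> /(mulr_ge0 (mulr_ge0 s0 t0)).
have -> : t = 1 - s by lra.
lra.
Qed.

(** The [P] constructed here is [C *m Cp], a projection onto the directions of the affine hull of
    the samples, so the pointwise inequality is obtained on that hull. The multipliers are found in
    the coordinates of [sample_factor] and pulled back along [Cp]. *)
Lemma multipliers_on_hull (v e : R) :
  (forall mu, ambiguity_set nm xihat theta tau mu ->
     (\int[mu]_u (Psi u)%:E <= v%:E)%E) -> 0 < e ->
  exists lam (G : 'M[R]_n) (P : 'M[R]_n) (y : 'I_N -> R),
    [/\ 0 <= lam, psd G, (1%:M - P) *m sample_cov xihat = 0,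
        forall i w, Psi (m + P *m w) <=
          y i + lam * nm (m + P *m w - xihat i) + dot w (G *m w) &
        lam * theta + tau * \tr (G *m sample_cov xihat) + N%:R^-1 * \sum_i y i
        <= v + e].
Proof.
move=> val e0.
have [r [C [W [Cp [Wp [CpC WWp xiE covE]]]]]] := sample_factor xihat.
have N0 : 0 < N%:R^-1 :> R by rewrite invr_gt0 ltr0n.
pose S := N%:R^-1 *: (W *m W^T).
have Ssym : S^T = S by rewrite /S linearZ/= trmx_mul trmxK.
pose f (i : 'I_N) (u : 'cV[R]_r) := Psi (m + C *m u).
pose c (i : 'I_N) (u : 'cV[R]_r) := nm (m + C *m u - xihat i).
have dotS w : dot w (S *m w) = N%:R^-1 * dot (W^T *m w) (W^T *m w).
  by rewrite /S -scalemxAl dotZr -mulmxA dot_mulmxl trmxK.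
pose kap := N%:R^-1 * \sum_i nm (C *m col i W).
have kap0 : 0 <= kap.
  by rewrite mulr_ge0 ?(ltW N0)//; apply: sumr_ge0 => i _; exact: is_norm_ge0.
(* With this factor the transport cost of the Slater point is [d * kap], strictly below [theta]. *)
pose d := theta / (theta + kap).
have tk : 0 < theta + kap by rewrite ltr_pwDl.
have d0 : 0 < d by rewrite divr_gt0.
have d1 : d <= 1 by rewrite ler_pdivrMr// mul1r lerDl.
(* Slater point: the samples contracted towards their mean. *)
pose u0 i := (1 - d) *: col i W.
have [||p pP pc pm|lam [G [lam0 Gp LG]]] :=
    @lagrange_multipliers R N r f c theta tau v S u0 Ssym.
- rewrite plan_avg1 /c.
  have -> : \sum_i nm (m + C *m u0 i - xihat i) = d * \sum_i nm (C *m col i W).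
    rewrite mulr_sumr; apply: eq_bigr => i _.
    rewrite xiE /u0 -scalemxAr scalerBl scale1r opprD addrACA subrr.
    rewrite add0r addrAC subrr add0r.
    by rewrite (is_normN nmP) (norm_homog nmP) gtr0_norm.
  rewrite mulrCA -/kap /d mulrAC ltr_pdivrMr// ltr_pM2l//.
  by rewrite ltrDr.
(* Since [S] is nonsingular, the form of [Z] is at least [- kz] times that of [S], while contracting
   frees at least [d] times it because [(1 - d) ^+ 2 <= 1 - d]; hence [t * kz <= d] suffices. *)
- move=> Z; pose Z' := Wp *m Z *m Wp^T.
  pose kz := N%:R * \sum_i \sum_j `|Z' i j|.
  have kz0 : 0 <= kz.
    by rewrite mulr_ge0// sumr_ge0// => i _; rewrite sumr_ge0.
  exists (d / (kz + 1)); first by rewrite divr_gt0// ltr_wpDl.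
  move=> t t0 td w; rewrite plan_avg1.
  have -> : N%:R^-1 * \sum_i dot (u0 i) w ^+ 2 = (1 - d) ^+ 2 * dot w (S *m w).
    rewrite dotS mulrCA; congr (_ * _); rewrite [dot (_ *m _) _]dotE mulr_sumr.
    apply: eq_bigr => i _; rewrite /u0 dotZl exprMn; congr (_ * _).
    have -> : (W^T *m w) i ord0 = dot (col i W) w.
      by rewrite dotE mxE; apply: eq_bigr => j _; rewrite !mxE.
    by rewrite expr2.
  have wE : w = Wp^T *m (W^T *m w) by rewrite mulmxA -trmx_mul WWp trmx1 mul1mx.
  have qZ : dot w (Z *m w) = dot (W^T *m w) (Z' *m (W^T *m w)).
    by rewrite {1 2}wE dot_mulmxl trmxK !mulmxA.
  have Sge0 : 0 <= dot w (S *m w).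
    by rewrite dotS mulr_ge0 ?dot_ge0// ltW.
  have hle (h : 'cV[R]_N) i j : `|h i ord0 * h j ord0| <= dot h h.
    have hi k : h k ord0 ^+ 2 <= dot h h.
      rewrite dotE (bigD1 k)//= expr2 lerDl sumr_ge0// => l _.
      by rewrite -expr2 sqr_ge0.
    have := hi i; have := hi j.
    have := sqr_ge0 (h i ord0 - h j ord0); have := sqr_ge0 (h i ord0 + h j ord0).
    rewrite ler_norml; nra.
  have qZ_ge : - (kz * dot w (S *m w)) <= dot w (Z *m w).
    rewrite qZ dot_mulmxE dotS; set h := W^T *m w.
    have -> : kz * (N%:R^-1 * dot h h) = \sum_i \sum_j `|Z' i j| * dot h h.
      rewrite /kz mulrACA mulfV ?mul1r ?pnatr_eq0 -?lt0n// mulr_suml.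
      by apply: eq_bigr => i _; rewrite mulr_suml.
    rewrite -sumrN; apply: ler_sum => i _; rewrite -sumrN; apply: ler_sum => j _.
    rewrite lerNl -mulNr (le_trans (ler_norm _))// normrM normrN.
    by rewrite ler_wpM2l.
  have tkz : t * kz <= d.
    move: td; rewrite ler_pdivlMr ?ltr_wpDl// mulrDr mulr1.
    by apply: le_trans; rewrite lerDl ltW.
  have dd : (1 - d) ^+ 2 <= 1 - d by nra.
  have H1 : (1 - d) ^+ 2 * dot w (S *m w) <= (1 - d) * dot w (S *m w).
    exact: ler_wpM2r.
  have H2 : t * kz * dot w (S *m w) <= d * dot w (S *m w) by exact: ler_wpM2r.
  have H3 : dot w (S *m w) <= tau * dot w (S *m w) by exact: ler_peMl.
  have H4 : t * - (kz * dot w (S *m w)) <= t * dot w (Z *m w).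
    by rewrite ler_pM2l.
  lra.
- have := @plan_ambiguity R n N N_gt0 nm nmP xihat theta tau
    [seq (q.1, (fun u => m + C *m u) \o q.2) | q <- p] (is_plan_map _ pP).
  rewrite (plan_avg_map (fun u => m + C *m u)).
  move=> /(_ pc) [w|mu muP int_mu].
    rewrite (plan_avg_map (fun u => m + C *m u)).
    have -> : dot w (sample_cov xihat *m w) = dot (C^T *m w) (S *m (C^T *m w)).
      by rewrite covE -/S dot_mulmxl trmxK !mulmxA.
    apply: le_trans (pm (C^T *m w)); apply: ler_sum => x _ /=.
    rewrite le_eqVlt; apply/orP; left; apply/eqP; congr (_ * (_ * _)).
    apply: eq_bigr => i _.
    by rewrite [m + _]addrC addrK dot_mulmxl.
  have := val mu muP; rewrite int_mu.
    by rewrite lee_fin (plan_avg_map (fun u => m + C *m u)).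
  exact: (measurable_max_affine Psi_ge0 Psi_ge Psi_attained).
pose B := v - lam * theta - tau * \tr (G *m S).
(* The multiplier inequality bounds sums over independent choices of [u i]; splitting it yields one
   [y i] per sample. *)
have [|y [Fy sumy]] := @separable_sup R N 'cV[R]_r 0
    (fun i u => f i u - lam * c i u - dot u (G *m u)) (N%:R * B) e _ e0.
  move=> u; have := LG u; rewrite -/B.
  by rewrite mulrC ler_pdivrMr ?ltr0n// mulrC.
exists lam, (Cp^T *m G *m Cp), (C *m Cp), y; split=> //.
- split=> [|w]; first by rewrite !trmx_mul trmxK (psdT Gp) mulmxA.
  have -> : Cp^T *m G *m Cp *m w = Cp^T *m (G *m (Cp *m w)) by rewrite !mulmxA.
  by rewrite -dot_mulmxl; exact: psd_ge0.
- rewrite covE !mulmxA mulmxBl mul1mx -[C *m Cp *m C]mulmxA CpC mulmx1 subrr.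
  by rewrite !mul0mx.
- move=> i w; have := Fy i (Cp *m w); rewrite /f /c !mulmxA.
  have -> : dot w (Cp^T *m G *m Cp *m w) = dot (Cp *m w) (G *m Cp *m w).
    by rewrite dot_mulmxl !mulmxA.
  lra.
have -> : \tr (Cp^T *m G *m Cp *m sample_cov xihat) = \tr (G *m S).
  rewrite covE -/S -!mulmxA mxtrace_mulC -!mulmxA.
  have -> : C^T *m Cp^T = 1%:M by rewrite -trmx_mul CpC trmx1.
  by rewrite mulmx1 [Cp *m (C *m S)]mulmxA CpC mul1mx.
have : N%:R^-1 * \sum_i y i <= B + e.
  rewrite mulrC ler_pdivrMr ?ltr0n//.
  by rewrite mulrDl mulrC [e * _]mulrC.
by rewrite /B; lra.
Qed.

(** Half of [e] is spent on the multipliers over the hull, half on leaving the hull. A point splits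
    into a hull part and [Q *m (u - m)]; moving by the latter changes a piece and the norm term by a
    Lipschitz amount, which the quadratic form added to [G] absorbs. *)
Lemma strong_duality (v e : R) :
  (forall mu, ambiguity_set nm xihat theta tau mu ->
     (\int[mu]_u (Psi u)%:E <= v%:E)%E) -> 0 < e ->
  exists (y : 'I_N -> R) (zeta : 'I_N -> K -> 'cV[R]_n) (lam : R) (G : 'M[R]_n),
    [/\ 0 <= lam, psd G,
        forall i k u, dot (a k) u + b k <=
          y i + dot (u - m) (G *m (u - m)) + dot (zeta i k) (u - xihat i),
        forall i k w, dot (zeta i k) w <= lam * nm w &
        lam * theta + tau * \tr (G *m sample_cov xihat) + N%:R^-1 * \sum_i y i
        <= v + e].
Proof.
move=> val e0; have e20 : 0 < e / 2 by rewrite divr_gt0.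
have [lam [G [P [y [lam0 Gp PS dual obj]]]]] := multipliers_on_hull val e20.
pose Q := 1%:M - P.
(* Bound, along coordinate [j], on the combined growth of any affine piece and of [lam * nm]. *)
pose gam (j : 'I_n) := \sum_k `|a k j ord0| + lam * nm (delta_mx j ord0).
have gam_ge0 j : 0 <= gam j.
  rewrite addr_ge0 ?mulr_ge0//; last exact: is_norm_ge0.
  by rewrite sumr_ge0.
pose E := \sum_j gam j ^+ 2.
have E0 : 0 <= E by rewrite sumr_ge0// => j _; rewrite sqr_ge0.
(* The weight of [Q^T Q] costs nothing in the objective, since [Q] kills the
   covariance; a large one confines [u - m] to the range of [P]. *)
pose t := (E + 1) / (2 * e).
have t0 : 0 < t by rewrite divr_gt0 ?mulr_gt0// ltr_wpDl.
have off k w : dot (a k) w + lam * nm w <= t * dot w w + e / 2.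
  have le1 : dot (a k) w + lam * nm w <= \sum_j gam j * `|w j ord0|.
    rewrite /gam; under eq_bigr do rewrite mulrDl.
    rewrite big_split/=; apply: lerD.
      rewrite dotE; apply: ler_sum => j _; rewrite (le_trans (ler_norm _))//.
      rewrite normrM ler_wpM2r// (bigD1 k)//= lerDl.
      by rewrite sumr_ge0.
    under eq_bigr do rewrite -mulrA; rewrite -mulr_sumr ler_wpM2l//.
    rewrite (le_trans (is_norm_le_coord nmP _))//.
    by apply: ler_sum => j _; rewrite mulrC.
  (* AM-GM, coordinatewise. *)
  have le2 : \sum_j gam j * `|w j ord0| <= t * dot w w + E / (4 * t).
    rewrite dotE mulr_sumr /E mulr_suml -big_split; apply: ler_sum => j _ /=.
    rewrite -expr2 -real_normK ?num_real//.
    have := sqr_ge0 (2 * t * `|w j ord0| - gam j) => /(fun h => divr_ge0 h (ltW t0)).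
    have -> : (2 * t * `|w j ord0| - gam j) ^+ 2 / t =
      4 * (t * `|w j ord0| ^+ 2 + gam j ^+ 2 / (4 * t) - gam j * `|w j ord0|).
      by field; rewrite lt0r_neq0.
    lra.
  have le3 : E / (4 * t) <= e / 2.
    rewrite /t; have -> : E / (4 * ((E + 1) / (2 * e))) = E / (E + 1) * (e / 2).
      by field; rewrite !lt0r_neq0// ltr_wpDl.
    by rewrite ger_pMl// ler_pdivrMr ?ltr_wpDl// mul1r lerDl.
  lra.
pose G' := G + t *: (Q^T *m Q).
have quadG' w : dot w (G' *m w) = dot w (G *m w) + t * dot (Q *m w) (Q *m w).
  rewrite /G' mulmxDl dotDr -scalemxAl dotZr; congr (_ + t * _).
  by rewrite -mulmxA -dot_mulmxl.
have Gp' : psd G'.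
  split=> [|w]; last first.
    by rewrite quadG' addr_ge0 ?psd_ge0// mulr_ge0 ?dot_ge0// ltW.
  by rewrite /G' linearD/= (psdT Gp) linearZ/= trmx_mul trmxK.
have dual' i k u : 0 <= (y i + e / 2 - dot (a k) u - b k
    + dot (u - m) (G' *m (u - m))) + lam * nm (u - xihat i).
  have uE : u = m + P *m (u - m) + Q *m (u - m).
    by rewrite /Q mulmxBl mul1mx -addrA [P *m _ + _]addrC subrK addrC subrK.
  have := dual i (u - m); have := Psi_ge k (m + P *m (u - m)).
  have := off k (Q *m (u - m)); rewrite quadG'.
  have : dot (a k) u =
      dot (a k) (m + P *m (u - m)) + dot (a k) (Q *m (u - m)).
    by rewrite -dotDr -uE.
  have tri : nm (m + P *m (u - m) - xihat i) <= nm (u - xihat i) + nm (Q *m (u - m)).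
    have <- : u - Q *m (u - m) = m + P *m (u - m) by rewrite {1}uE addrK.
    by rewrite -[nm (Q *m _)](is_normN nmP) addrAC (norm_triangle nmP).
  have := ler_wpM2l lam0 tri; rewrite mulrDr.
  lra.
(* One vector per sample and piece replaces the norm term by a linear one, the remaining terms being
   convex in [u]. *)
have /choice[z zP] (ik : 'I_N * K) : exists z,
    (forall w, dot z w <= lam * nm w) /\ (forall u, 0 <= (y ik.1 + e / 2
      - dot (a ik.2) u - b ik.2 + dot (u - m) (G' *m (u - m)))
      + dot z (u - xihat ik.1)).
  apply: (@norm_penalty_dual _ _ nm nmP (fun u => y ik.1 + e / 2
    - dot (a ik.2) u - b ik.2 + dot (u - m) (G' *m (u - m))) lam (xihat ik.1))
    => // u w s s' s0 s'0 ss1.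
  have -> : s *: u + s' *: w - m = s *: (u - m) + s' *: (w - m).
    rewrite !scalerBr addrACA -opprD -scalerDl ss1 scale1r//.
  have := quad_convex (u - m) (w - m) Gp' (ltW s0) (ltW s'0) ss1.
  rewrite dotDr !dotZr; have -> : s' = 1 - s by lra.
  lra.
exists (fun i => y i + e / 2), (fun i k => z (i, k)), lam, G'; split=> //.
- by move=> i k u; have := (zP (i, k)).2 u; rewrite /=; lra.
- by move=> i k w; exact: (zP (i, k)).1.
have -> : \tr (G' *m sample_cov xihat) = \tr (G *m sample_cov xihat).
  by rewrite /G' mulmxDl -scalemxAl -mulmxA PS mulmx0 scaler0 addr0.
rewrite big_split/= sumr_const card_ord mulrDr -[(e / 2) *+ N]mulr_natl.
by rewrite mulKf ?pnatr_eq0 -?lt0n//; lra.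
Qed.

End StrongDuality.

(** * The dispatch model *)

Section Dispatch.
Variables (R : realType) (gen load wind line : finType).
Variable D : grid R gen load wind line.
Hypothesis beta_load_ge0 : 0 <= beta_load D.
Hypothesis beta_wind_ge0 : 0 <= beta_wind D.
Hypothesis beta_line_ge0 : 0 <= beta_line D.
Variable x : decision R gen.
Local Notation dim := (#|wind| + #|line|)%N.
Implicit Types (xi : 'cV[R]_dim) (k : piece_index gen line).

Lemma PsiE xi : Psi D x xi =
  \sum_g (beta_load D * Num.max (shed D x xi g) 0
          + beta_wind D * Num.max (curtail D x xi g) 0)
  + \sum_l beta_line D * Num.max (`|flow D x xi l| - rline xi l) 0.
Proof. by rewrite /Psi !mulr_sumr -big_split. Qed.

Lemma Psi_ge0 xi : 0 <= Psi D x xi.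
Proof.
rewrite PsiE addr_ge0// sumr_ge0// => i _.
  by rewrite addr_ge0// mulr_ge0// le_max lexx orbT.
by rewrite mulr_ge0// le_max lexx orbT.
Qed.

Lemma piece_le_Psi k xi : dot (a_ D k x) xi + b_ D k x <= Psi D x xi.
Proof.
rewrite piece_affine PsiE; apply: lerD; apply: ler_sum => i _.
  have pos (c t : R) : 0 <= c -> 0 <= c * Num.max t 0.
    by move=> c0; rewrite mulr_ge0// le_max lexx orbT.
  apply: lerD; rewrite /A_load /A_wind; case: (val _) => [|_]; try exact: pos.
    by rewrite ler_wpM2l// le_max lexx.
  by rewrite ler_wpM2l// le_max lexx.
rewrite /A_line; case: (val _) => [|[|_]].
- rewrite ler_wpM2l// le_max; apply/orP; left.
  by rewrite lerD2r ler_norm.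
- rewrite ler_wpM2l// le_max; apply/orP; left.
  by rewrite lerD2r -normrN ler_norm.
- by rewrite mulr_ge0// le_max lexx orbT.
Qed.

Lemma Psi_attained xi : exists k, Psi D x xi = dot (a_ D k x) xi + b_ D k x.
Proof.
pose jd := [ffun g => if 0 <= shed D x xi g then ord0 else lift ord0 ord0 : 'I_2].
pose jw := [ffun g => if 0 <= curtail D x xi g then ord0 else lift ord0 ord0 : 'I_2].
pose jl := [ffun l => if 0 <= `|flow D x xi l| - rline xi l then
  (if 0 <= flow D x xi l then ord0 else lift ord0 ord0)
  else lift ord0 (lift ord0 ord0) : 'I_3].
exists (jd, jw, jl); rewrite piece_affine PsiE; congr (_ + _).
  apply: eq_bigr => g _; rewrite /A_load /A_wind /= !ffunE; congr (_ + _).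
    by case: leP => /=; rewrite ?mulr0.
  by case: leP => /=; rewrite ?mulr0.
apply: eq_bigr => l _; rewrite /A_line /= ffunE.
case: (leP 0 (`|_| - _)) => /= _; last by rewrite mulr0.
by case: (leP 0 (flow D x xi l)) => /= fl; [rewrite ger0_norm|rewrite ltr0_norm].
Qed.

Section Lmi.
Variables (N : nat) (xihat : 'I_N -> 'cV[R]_dim).
Local Notation m := (sample_mean xihat).

(** Both sides express nonnegativity of one quadratic polynomial in [u]: expanding it around the
    origin instead of [m] produces [lmi_offdiag] and [lmi_corner]. *)
Lemma lmi_psdP k i (yi : R) z (G : 'M[R]_dim) : psd G ->
  psd (lmi D xihat k x i yi z G) <->
  forall u, dot (a_ D k x) u + b_ D k x <=
    yi + dot (u - m) (G *m (u - m)) + dot z (u - xihat i).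
Proof.
move=> Gp; rewrite /lmi psd_block//.
have E u : dot u (G *m u) + 2 * dot (lmi_offdiag D xihat k x z G) u
    + lmi_corner D xihat k x i yi z G =
    yi + dot (u - m) (G *m (u - m)) + dot z (u - xihat i)
    - (dot (a_ D k x) u + b_ D k x).
  rewrite quadD ?(psdT Gp)// mulmxN !dotNr dotNl opprK.
  rewrite /lmi_offdiag /lmi_corner !dotDl !dotNl !dotZl dotDr dotNr.
  rewrite [dot (G *m m) u]dotC; lra.
by split=> H u; [rewrite -subr_ge0 -E|rewrite E subr_ge0].
Qed.

End Lmi.

End Dispatch.

(** * Equality of the worst-case and conic values *)

Section Reformulation.
Variables (R : realType) (gen load wind line : finType).
Variable D : grid R gen load wind line.
Hypothesis beta_load_ge0 : 0 <= beta_load D.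
Hypothesis beta_wind_ge0 : 0 <= beta_wind D.
Hypothesis beta_line_ge0 : 0 <= beta_line D.
Variable nm : 'cV[R]_(#|wind| + #|line|) -> R.
Hypothesis nmP : is_norm nm.
Variables (N : nat) (N_gt0 : (0 < N)%N).
Variable xihat : 'I_N -> 'cV[R]_(#|wind| + #|line|).
Variables (theta tau : R) (theta_gt0 : 0 < theta) (tau_ge1 : 1 <= tau).

Lemma dro_objective_dual (x : decision R gen) : feasible D x ->
  dro_objective D nm xihat theta tau x =
  ereal_inf [set v : \bar R | exists y zeta lam Gam,
    conic_feasible D nm xihat x y zeta lam Gam /\
    v = (conic_objective D xihat theta tau x y lam Gam)%:E].
Proof.
move=> xF; apply/eqP; rewrite eq_le; apply/andP; split.
  apply: le_ereal_inf_tmp => _ [y [zeta [lam [G [[lam0 Gp L Z _] ->]]]]].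
  rewrite /dro_objective /conic_objective -!addrA EFinD leeD2l//.
  apply: ge_ereal_sup => _ [mu muM <-]; rewrite unlock !addrA.
  apply: (weak_duality (Psi_ge0 _ _ _ _) (piece_le_Psi _ _ _ _)
    (@Psi_attained _ _ _ _ _ D x) nmP N_gt0 lam0 Gp (zeta := zeta) _ _ muM) => //.
    by move=> i k u; have /(lmi_psdP _ _ _ _ _ _ _ Gp) := L k i; exact.
  move=> i k w; apply: (le_trans (dual_normP nmP _ _)).
  by rewrite ler_wpM2r ?is_norm_ge0.
set V := ereal_inf _.
(* Strong duality is applied under a real upper bound on the worst case; its infinite values are
   treated separately below. *)
have VW (v : R) : (worst_case D nm xihat theta tau x <= v%:E)%E ->
    (V <= (cost D x + v)%:E)%E.
  move=> Wv; apply/lee_addgt0Pr => e e0.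
  have [||||y [zeta [lam [G [lam0 Gp L Z obj]]]]] :=
    @strong_duality R _ _ (a_ D ^~ x) (b_ D ^~ x) (Psi D x) _ _ _
      nm nmP N N_gt0 xihat theta tau theta_gt0 tau_ge1 v e _ e0.
  - exact: Psi_ge0.
  - by move=> k u; exact: piece_le_Psi.
  - exact: Psi_attained.
  - move=> mu muM; apply: le_trans Wv; apply: ereal_sup_ubound.
    by exists mu => //; rewrite unlock.
  apply: (@le_trans _ _ (conic_objective D xihat theta tau x y lam G)%:E).
    apply: ereal_inf_lbound; exists y, zeta, lam, G; split=> //; split=> //.
      by move=> k i; apply/lmi_psdP => // u; exact: L.
    by move=> k i; apply: dual_norm_le_bound => // u; exact: Z.
  by rewrite -EFinD lee_fin /conic_objective; lra.
rewrite /dro_objective; case: (worst_case _ _ _ _ _ _) VW => [w VW||VW].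
- exact: VW.
- by move=> _; rewrite addey// leey.
(* If the worst case is [-oo], every real bounds it, so [V] lies below every real and is [-oo] as
   well. *)
- have {}VW w : (V <= w%:E)%E.
    by have := VW (w - cost D x) (leNye _); rewrite addrC subrK.
  rewrite addeNy; case EV : V => [r||] //.
    by have := VW (r - 1); rewrite EV lee_fin lerBrDr gerDl ler10.
  by have := VW 0; rewrite EV.
Qed.

End Reformulation.

Theorem theorem1 (R : realType) (gen load wind line : finType)
  (gen_ne : (0 < #|gen|)%N) (load_ne : (0 < #|load|)%N)
  (wind_ne : (0 < #|wind|)%N) (line_ne : (0 < #|line|)%N)
  (D : grid R gen load wind line)
  (pmin_le_pmax : forall g, pmin D g <= pmax D g)
  (beta_load_ge0 : 0 <= beta_load D) (beta_wind_ge0 : 0 <= beta_wind D)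
  (beta_line_ge0 : 0 <= beta_line D)
  (cost_gen_quad : forall g, strictly_convex_quadratic (cost_gen D g))
  (cost_up_quad : forall g, strictly_convex_quadratic (cost_up D g))
  (cost_down_quad : forall g, strictly_convex_quadratic (cost_down D g))
  (nm : 'cV[R]_(#|wind| + #|line|) -> R) (nm_norm : is_norm nm)
  (N : nat) (N_gt0 : (0 < N)%N)
  (xihat : 'I_N -> 'cV[R]_(#|wind| + #|line|))
  (theta tau : R) (theta_gt0 : 0 < theta) (tau_ge1 : 1 <= tau) :
  (forall x : decision R gen, feasible D x ->
     dro_objective D nm xihat theta tau x =
     ereal_inf [set v : \bar R | exists y zeta lam Gam,
       conic_feasible D nm xihat x y zeta lam Gam /\
       v = (conic_objective D xihat theta tau x y lam Gam)%:E])
  /\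
  ereal_inf [set dro_objective D nm xihat theta tau x | x in feasible D] =
  ereal_inf [set v : \bar R | exists x y zeta lam Gam,
    conic_feasible D nm xihat x y zeta lam Gam /\
    v = (conic_objective D xihat theta tau x y lam Gam)%:E].
Proof.
have dual x : feasible D x -> _ :=
  dro_objective_dual beta_load_ge0 beta_wind_ge0 beta_line_ge0 nm_norm N_gt0
    xihat theta_gt0 tau_ge1 (x := x).
split; first exact: dual.
apply/eqP; rewrite eq_le; apply/andP; split; apply: le_ereal_inf_tmp.
  move=> _ [x [y [zeta [lam [G [F ->]]]]]].
  have xF := conic_x F.
  apply: (@le_trans _ _ (dro_objective D nm xihat theta tau x)).
    by apply: ereal_inf_lbound; exists x.
  by rewrite dual//; apply: ereal_inf_lbound; exists y, zeta, lam, G.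
move=> _ [x xF <-]; rewrite dual//; apply: ereal_inf_le_tmp.
by move=> v [y [zeta [lam [G FG]]]]; exists x, y, zeta, lam, G.
Qed.
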